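(* Let $r\ge0$ be an integer and $J\subseteq\mathbb{N}_0$ finite. Let $\mathcal{X}$ be the determinantal point process on $\mathbb{C}$ with correlation kernel $$K(z,z')=e^{-\frac{\pi}{2}(|z|^2+|z'|^2)}\sum_{j\in J}H_{j,r}(z,\overline z)\,\overline{H_{j,r}(z',\overline{z'})}.$$ Then the point process $|\mathcal{X}|=\sum_{x\in\mathcal{X}}\delta_{|x|}$ on $[0,\infty)$ has the same distribution as the point process $\sum_{j\in J}\delta_{Y_j}$, where the $Y_j$, $j\in J$, are independent random variables with densities $$f_{Y_j}(x)=2\frac{\pi^{j-r+1}r!}{j!}x^{2(j-r)+1}\big[L_r^{j-r}(\pi x^2)\big]^2e^{-\pi x^2},\qquad x\ge 0.$$ (Equivalently, $Y_j^2$ has density $\frac{\pi^{j-r+1}r!}{j!}x^{j-r}[L_r^{j-r}(\pi x)]^2e^{-\pi x}$.)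
   Context: Laguerre polynomials: $L_j^{\alpha}(x)=\sum_{i=0}^{j}(-1)^i\binom{j+\alpha}{j-i}\frac{x^i}{i!}$ for $j\ge0$, $j+\alpha\ge0$. Complex Hermite polynomials: $H_{j,r}(z,\overline z)=\sqrt{\frac{r!}{j!}}\pi^{\frac{j-r}{2}}z^{j-r}L_r^{j-r}(\pi|z|^2)$ if $j>r$, and $H_{j,r}(z,\overline z)=(-1)^{r-j}\sqrt{\frac{j!}{r!}}\pi^{\frac{r-j}{2}}\overline{z}^{\,r-j}L_j^{r-j}(\pi|z|^2)$ if $j\le r$. This process is the $(r,J)$-pure polyanalytic ensemble. *)

(* Defs.v *)
From HB Require Import structures.
From mathcomp Require Import all_boot all_order all_algebra.
From mathcomp Require Import all_classical all_reals all_analysis.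
From mathcomp Require Import measurable_realfun complex.
Set Implicit Arguments. Unset Strict Implicit. Unset Printing Implicit Defensive.
Import Order.TTheory GRing.Theory Num.Theory.
Import numFieldNormedType.Exports.
Local Open Scope classical_set_scope.
Local Open Scope ring_scope.

Section PolyanalyticDefs.
Variable R : realType.

(* Generalized Laguerre polynomial L_j^a(x), a : int, j + a >= 0:
   sum_{i=0}^j (-1)^i binom(j+a, j-i) x^i / i!  *)
Definition laguerre (j : nat) (a : int) (x : R) : R :=
  \sum_(i < j.+1) (-1) ^+ i * ('C(absz (j%:Z + a), j - i))%:R * x ^+ i / (i`!)%:R.

Definition toC (z : R * R) : R[i] := Complex z.1 z.2.

Definition sqnorm (z : R * R) : R := z.1 ^+ 2 + z.2 ^+ 2.

Definition modulus (z : R * R) : R := Num.sqrt (sqnorm z).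

Definition hermiteC (j r : nat) (z : R * R) : R[i] :=
  let w := toC z in
  if (r < j)%N then
    (Num.sqrt ((r`!)%:R / (j`!)%:R) * Num.sqrt pi ^+ (j - r)
       * laguerre r (j%:Z - r%:Z) (pi * sqnorm z))%:C%C * w ^+ (j - r)
  else
    ((-1) ^+ (r - j) * Num.sqrt ((j`!)%:R / (r`!)%:R) * Num.sqrt pi ^+ (r - j)
       * laguerre j (r%:Z - j%:Z) (pi * sqnorm z))%:C%C * (conjc w) ^+ (r - j).

Definition kernelK (r : nat) (J : seq nat) (z z' : R * R) : R[i] :=
  (expR (- (pi / 2) * (sqnorm z + sqnorm z')))%:C%C
  * \sum_(j <- J) hermiteC j r z * conjc (hermiteC j r z').

(* k-point correlation function rho_k(z_1,...,z_k) = det[K(z_i,z_j)]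
   (this determinant is real, since the matrix is Hermitian) *)
Definition corrK (K : R * R -> R * R -> R[i]) (s : seq (R * R)) : R :=
  complex.Re (\det (\matrix_(i < size s, j < size s) K (nth (0, 0) s i) (nth (0, 0) s j))).

Definition leb2 := (@lebesgue_measure R \x @lebesgue_measure R)%E.

Fixpoint iintB (Bs : seq (set (R * R))) (F : seq (R * R) -> \bar R) : \bar R :=
  match Bs with
  | [::] => F [::]
  | B :: Bs' => (\int[leb2]_(z in B) iintB Bs' (fun s => F (z :: s)))%E
  end.

Definition prod_counts (mu : set (R * R) -> \bar R) (Bs : seq (set (R * R))) : \bar R :=
  foldr (fun B acc => (mu B * acc)%E) 1%E Bs.

Definition bounded2 (B : set (R * R)) : Prop :=
  exists M : R, forall z, B z -> `|z.1| <= M /\ `|z.2| <= M.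

(* A simple, locally finite point process on C = R^2 given as a random
   counting measure N, and the determinantal property with kernel K
   (Hough-Krishnapur-Peres-Virag, Def. 1.2.2 and 4.2.1): for mutually
   disjoint Borel sets D_1..D_k,
   E[ N(D_1) ... N(D_k) ] = int_{D_1 x ... x D_k} det[K(z_i,z_j)] dz. *)
Definition is_simple_point_process {d} {Omega : measurableType d}
    (P : probability Omega R) (N : Omega -> {measure set (R * R) -> \bar R}) : Prop :=
  [/\ forall B, measurable B -> measurable_fun setT (fun w => N w B),
      forall w B, measurable B ->
        (exists n : nat, N w B = (n%:R)%:E) \/ N w B = +oo%E,
      forall w B, measurable B -> bounded2 B -> (N w B < +oo)%E
    & forall w z, (N w [set z] <= 1)%E].

Definition is_determinantal {d} {Omega : measurableType d}
    (P : probability Omega R) (N : Omega -> {measure set (R * R) -> \bar R})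
    (K : R * R -> R * R -> R[i]) : Prop :=
  is_simple_point_process P N /\
  forall Bs : seq (set (R * R)),
    (forall B, B \in Bs -> measurable B) ->
    (forall i j, (i < j < size Bs)%N -> nth set0 Bs i `&` nth set0 Bs j = set0) ->
    (\int[P]_w prod_counts (N w) Bs)%E = iintB Bs (fun s => (corrK K s)%:E).

Definition densY (r j : nat) (x : R) : R :=
  if 0 <= x then
    2 * pi ^ (j%:Z - r%:Z + 1) * (r`!)%:R / (j`!)%:R * x ^ (2 * (j%:Z - r%:Z) + 1)
      * (laguerre r (j%:Z - r%:Z) (pi * x ^+ 2)) ^+ 2 * expR (- pi * x ^+ 2)
  else 0.

Definition has_density {d} {Omega : measurableType d} (P : probability Omega R)
    (Y : Omega -> R) (f : R -> R) : Prop :=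
  forall B : set R, measurable B ->
    P (Y @^-1` B) = (\int[@lebesgue_measure R]_(x in B) (f x)%:E)%E.

Definition mutually_independent {d} {Omega : measurableType d} (P : probability Omega R)
    (J : seq nat) (Y : nat -> Omega -> R) : Prop :=
  forall B : nat -> set R, (forall j, measurable (B j)) ->
    P (\bigcap_(j in [set` J]) (Y j @^-1` B j)) =
    (\big[*%E/1%E]_(j <- J) P (Y j @^-1` B j))%E.

End PolyanalyticDefs.

(* Main.v *)
(** Write [phi j] for the [j]-th Hermite function times the Gaussian and [n] for
    the size of [J], so that the kernel is [sum_(j in J) phi j z * conj (phi j z')].

    The kernel has rank at most [n], so more than [n] disjoint cells are never
    all occupied; refining the cells, simplicity gives at most [n] points, and
    since the expected number of points is [n], there are exactly [n] of them.

    For [n] disjoint annuli, the determinant is [|det (phi j (z i))|^2].  As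
    [phi j] acquires the phase [zeta^(j - r)] under the rotation by [zeta], the
    products [phi a * conj (phi b)], [a <> b], integrate to [0] over annuli, and
    the expected product of the [n] counts is a permanent of the masses of the
    densities of the [Y j].  The independent variables yield the same permanent.

    When the total count is [n], the product of the counts over a set [S] of [n]
    cells of a partition is the indicator of the event that [S] is exactly the
    set of occupied cells, each holding one point.  So these events have the same
    probability for both processes.  As the partition refines, two of the [Y j]
    share a cell with probability tending to [0]; hence these events exhaust both
    probability spaces in the limit, in particular no two points of the
    determinantal process have the same modulus. *)
Require Import Defs.
From HB Require Import structures.
From mathcomp Require Import all_boot all_order all_algebra.
From mathcomp Require Import all_classical all_reals all_analysis.
From mathcomp Require Import measurable_realfun complex perm zify ring lra.
Set Implicit Arguments. Unset Strict Implicit. Unset Printing Implicit Defensive.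
Import Order.TTheory GRing.Theory Num.Theory.
Import numFieldNormedType.Exports.
Local Open Scope classical_set_scope.
Local Open Scope ring_scope.

(** * Rotations and polar coordinates *)

Lemma ge0_integral_transfer d1 d2 (X : measurableType d1) (Y : measurableType d2)
    (R : realType) (m1 : {measure set X -> \bar R}) (m2 : {measure set Y -> \bar R})
    (phi : X -> Y) (a : {nonneg R}) (D : set Y) (f : Y -> \bar R) :
  measurable_fun setT phi ->
  (forall A, measurable A -> m2 A = (a%:num%:E * m1 (phi @^-1` A))%E) ->
  measurable D -> measurable_fun D f -> (forall y, 0 <= f y)%E ->
  (\int[m2]_(y in D) f y = a%:num%:E * \int[m1]_(x in phi @^-1` D) f (phi x))%E.
Proof.
move=> mphi m2E mD mf f0.
(* The pushforward is repackaged as an opaque measure [p], which hides the measurability proof from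
   the rewriting. *)
have [p pE] : exists p : {measure set Y -> \bar R},
    p = pushforward m1 phi :> (set Y -> \bar R).
  pose p := (pushforward m1 phi : {measure set Y -> \bar R}).
  by exists (p mphi).
rewrite -[in RHS]/(\int[m1]_(x in phi @^-1` D) (f \o phi) x)%E.
rewrite -(ge0_integral_pushforward mphi)// -pE.
rewrite -(ge0_integral_mscale p mD a)//.
by apply: eq_measure_integral => A mA _; rewrite m2E//= /mscale pE.
Qed.

Section LebesgueChangeOfVariables.
Variable R : realType.
Local Notation mu := (@lebesgue_measure R).
Local Open Scope ereal_scope.

Lemma measurable_affine (a b : R) :
  measurable_fun setT (fun x : measurableTypeR R => (a * x + b)%R : measurableTypeR R).
Proof. by apply: measurable_funD => //; apply: measurable_funM. Qed.

(** By uniqueness of Lebesgue measure: the scaled pushforward gives half-open intervals their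
    length. *)
Lemma lebesgue_measure_affine (a b : R) (A : set (measurableTypeR R)) :
  (0 < a)%R -> measurable A ->
  mu A = a%:E * mu ((fun x => (a * x + b)%R) @^-1` A).
Proof.
move=> a0 mA.
pose f := (fun x : measurableTypeR R => (a * x + b)%R : measurableTypeR R).
have a0' : (0 <= a)%R by exact: ltW.
pose m2 := mscale (NngNum a0') (pushforward mu f).
rewrite (@lebesgue_measure_unique R (m2 (measurable_affine a b))) //= => _ [[c d]] _ <- /=.
rewrite /m2 /mscale /= -[pushforward mu f _]/(mu (f @^-1` _)).
have -> : f @^-1` `]c, d]%classic = `]((c - b) / a)%R, ((d - b) / a)%R]%classic.
  apply/seteqP; split => x /=; rewrite !in_itv/= /f ltr_pdivrMr// ler_pdivlMr//;
  by move=> /andP[? ?]; apply/andP; split; lra.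
rewrite !lebesgue_measure_itv/= !lte_fin.
rewrite ltr_pM2r ?invr_gt0// ltrD2r.
case: ifPn => _; last by rewrite mule0.
by rewrite -EFinM -!EFinB; congr EFin; field; rewrite gt_eqF.
Qed.

Lemma ge0_integral_affine (a b : R) (f : R -> \bar R) :
  (0 < a)%R -> measurable_fun [set: measurableTypeR R] f -> (forall x, 0 <= f x) ->
  \int[mu]_x f x = a%:E * \int[mu]_x f (a * x + b)%R.
Proof.
move=> a0 mf f0.
rewrite (ge0_integral_transfer (m1 := mu) (a := NngNum (ltW a0))
  (measurable_affine a b))//.
by move=> A mA; exact: lebesgue_measure_affine.
Qed.

Lemma integralT_oneDsqr : \int[mu]_x ((oneDsqr x)^-1)%:E = pi%:E.
Proof.
rewrite ge0_symfun_integralT//=; last 2 first.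
- exact: continuous_oneDsqrV.
- by move=> x /=; rewrite /oneDsqr sqrrN.
rewrite (_ : [set x | _] = `[0%R, +oo[%classic); last first.
  by apply/seteqP; split => x/=; rewrite in_itv/= andbT.
by rewrite integral0y_oneDsqr -EFinM mulrCA divff// mulr1.
Qed.

Local Notation leb2 := (@leb2 R).

Lemma ge0_integral_leb2 (f : R * R -> \bar R) : measurable_fun setT f ->
  (forall z, 0 <= f z) -> \int[leb2]_z f z = \int[mu]_x \int[mu]_y f (x, y).
Proof. by move=> mf f0; rewrite /Defs.leb2 fubini_tonelli1. Qed.

Lemma measurable_linear2 (a b : R) :
  measurable_fun [set: R * R] (fun z : R * R => (a * z.1 + b * z.2)%R).
Proof.
by apply: measurable_funD; apply: measurable_funM.
Qed.

Lemma measurable_matrix2 (a b c d : R) : measurable_fun [set: R * R]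
  (fun z : R * R => ((a * z.1 + b * z.2)%R, (c * z.1 + d * z.2)%R) : R * R).
Proof.
by apply/measurable_fun_pairP; split; exact: measurable_linear2.
Qed.

Lemma measurable_comp_matrix2 (f : R * R -> \bar R) (a b c d : R) :
  measurable_fun [set: R * R] f -> measurable_fun [set: R * R]
    (fun z : R * R => f ((a * z.1 + b * z.2)%R, (c * z.1 + d * z.2)%R)).
Proof. by move=> mf; exact: (measurableT_comp mf (measurable_matrix2 a b c d)). Qed.

Lemma ge0_integral_shear1 (t : R) (f : R * R -> \bar R) :
  measurable_fun setT f -> (forall z, 0 <= f z) ->
  \int[leb2]_z f ((1 * z.1 + t * z.2)%R, (0 * z.1 + 1 * z.2)%R) = \int[leb2]_z f z.
Proof.
move=> mf f0.
rewrite /Defs.leb2 !(@fubini_tonelli2 _ _ _ _ R mu mu)//; last first.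
  exact: measurable_comp_matrix2.
apply: eq_integral => y _; rewrite /fubini_G.
rewrite [RHS](@ge0_integral_affine 1 (t * y) (fun x => f (x, y)))//.
  by rewrite mul1e; apply: eq_integral => x _ /=; rewrite !(mul0r, add0r, mul1r).
by apply: measurableT_comp => //; exact: measurable_pair2.
Qed.

Lemma ge0_integral_shear2 (t : R) (f : R * R -> \bar R) :
  measurable_fun setT f -> (forall z, 0 <= f z) ->
  \int[leb2]_z f ((1 * z.1 + 0 * z.2)%R, (t * z.1 + 1 * z.2)%R) = \int[leb2]_z f z.
Proof.
move=> mf f0.
rewrite /Defs.leb2 !(@fubini_tonelli1 _ _ _ _ R mu mu)//; last first.
  exact: measurable_comp_matrix2.
apply: eq_integral => x _; rewrite /fubini_F.
rewrite [RHS](@ge0_integral_affine 1 (t * x) (fun y => f (x, y)))//.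
  by rewrite mul1e; apply: eq_integral => y _ /=; rewrite !(mul0r, addr0, mul1r) addrC.
by apply: measurableT_comp => //; exact: measurable_pair1.
Qed.

(* A rotation other than the half-turn is a product of three shears. *)
Lemma ge0_integral_rotation (c s : R) (f : R * R -> \bar R) :
  (c ^+ 2 + s ^+ 2 = 1)%R -> (c != -1)%R ->
  measurable_fun setT f -> (forall z, 0 <= f z) ->
  \int[leb2]_z f ((c * z.1 - s * z.2)%R, (s * z.1 + c * z.2)%R) = \int[leb2]_z f z.
Proof.
move=> cs c1 mf f0.
have c10 : (1 + c != 0)%R by apply: contra_neq c1 => h; lra.
(* The tangent of half the rotation angle, defined because [c != -1]. *)
pose t := (s / (1 + c))%R.
have mf1 : measurable_fun setT
    (fun z : R * R => f ((1 * z.1 + - t * z.2)%R, (0 * z.1 + 1 * z.2)%R)).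
  exact: measurable_comp_matrix2.
rewrite -[RHS](@ge0_integral_shear1 (- t))//.
rewrite -[RHS](@ge0_integral_shear2 s)//=.
rewrite -[RHS](@ge0_integral_shear1 (- t))//=; last first.
  exact: (@measurable_comp_matrix2 _ _ _ _ _ mf1).
have ts : (t * s = 1 - c)%R.
  rewrite /t mulrAC -expr2 (_ : s ^+ 2 = (1 - c) * (1 + c))%R ?mulfK//.
  by rewrite -(addrK (c ^+ 2)%R (s ^+ 2)%R) (addrC (s ^+ 2)%R) cs; ring.
have tc : (t * c = s - t)%R by rewrite /t; field.
apply: eq_integral => -[x y] _ /=; congr (f (_, _)).
  transitivity ((1 - t * s) * x - (t * (1 - t * s) + t) * y)%R; last by ring.
  by rewrite ts; rewrite opprB addrCA subrr addr0 tc subrK.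
transitivity (s * x + (1 - t * s) * y)%R; last by ring.
by rewrite ts; congr (_ + _ * _)%R; ring.
Qed.

Lemma measurable_sqnorm : measurable_fun setT (sqnorm (R := R)).
Proof.
by apply: measurable_funD; apply: measurable_funX.
Qed.

Lemma measurable_modulus : measurable_fun setT (modulus (R := R)).
Proof.
apply: measurableT_comp; last exact: measurable_sqnorm.
by apply: continuous_measurable_fun => x; exact: sqrt_continuous.
Qed.

Lemma ge0_integral_even (k : R -> \bar R) :
  measurable_fun [set: measurableTypeR R] k -> (forall x, 0 <= k x) ->
  \int[mu]_x k `|x|%R = 2%:E * \int[mu]_(x in `[0%R, +oo[) k x.
Proof.
move=> mk k0.
have mka : measurable_fun [set: measurableTypeR R] (fun x => k `|x|%R).
  by apply: (measurableT_comp mk); exact: normr_measurable.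
rewrite -(setUv `[0%R, +oo[%classic) ge0_integral_setU//=; last 3 first.
- exact: measurableC.
- by rewrite setUv.
- exact/disj_setPCl.
rewrite setCitvr (integral_itv_bndo_bndc (measurable_funTS mka)).
have E : \int[mu]_(x in `[0%R, +oo[) k `|x|%R = \int[mu]_(x in `[0%R, +oo[) k x.
  by apply: eq_integral => x; rewrite inE/= in_itv/= andbT => x0; rewrite ger0_norm.
rewrite E [X in _ + X](_ : _ = \int[mu]_(x in `[0%R, +oo[) k x).
  by rewrite -[2%R]/(1 + 1)%R EFinD ge0_muleDl ?mul1e ?lee_fin.
rewrite -E (ge0_integration_by_substitution0 mka)//.
by apply: eq_integral => x _; rewrite normrN.
Qed.

(* Substitute [y = |x| * s], exchange the integrals and rescale [x] by
   [sqrt (1 + s ^ 2)]: the angular factor is the integral of [1 / (1 + s ^ 2)]. *)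
Lemma ge0_integral_polar (g : R -> \bar R) :
  measurable_fun [set: measurableTypeR R] g -> (forall x, 0 <= g x) ->
  \int[leb2]_z g (modulus z) =
  \int[mu]_(x in `[0%R, +oo[) ((2 * pi * x)%:E * g x).
Proof.
move=> mg g0.
pose k (x : R) := `|x|%:E * g x.
have mk : measurable_fun [set: measurableTypeR R] k.
  apply: emeasurable_funM => //; apply/measurable_EFinP; exact: normr_measurable.
pose F (z : R * R) : \bar R := `|z.1|%:E * g (`|z.1| * Num.sqrt (oneDsqr z.2))%R.
have F0 z : 0 <= F z by rewrite mule_ge0// lee_fin.
have msq : measurable_fun [set: measurableTypeR R] (fun x => Num.sqrt (oneDsqr x)).
  apply: continuous_measurable_fun => x; apply: continuous_comp.
    exact: continuous_oneDsqr.
  exact: sqrt_continuous.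
have mn1 : measurable_fun [set: R * R] (fun z : R * R => `|z.1|%R).
  by apply: (measurableT_comp (@normr_measurable R setT)).
have mF : measurable_fun [set: R * R] F.
  apply: emeasurable_funM; first exact/measurable_EFinP.
  apply: (measurableT_comp mg); apply: measurable_funM => //.
  exact: (measurableT_comp msq).
have mgm : measurable_fun [set: R * R] (fun z => g (modulus z)).
  by apply: (measurableT_comp mg); exact: measurable_modulus.
rewrite ge0_integral_leb2//.
transitivity (\int[mu]_x \int[mu]_s F (x, s)).
  have mg1 := measurable_fun_fubini_tonelli_F (m2 := mu) _ mgm (fun z => g0 (modulus z)).
  have mF1 := measurable_fun_fubini_tonelli_F (m2 := mu) _ mF F0.
  apply: ge0_ae_eq_integral => //.
  - by move=> x _; exact: integral_ge0.
  - by move=> x _; exact: integral_ge0.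
  (* At [x = 0] the substitution degenerates, but a single point is null. *)
  exists [set 0%R]; split => //; first exact: lebesgue_measure_set1.
  move=> x /= /not_implyP[_ h]; apply: contrapT => /= x0; apply: h.
  have x0' : (0 < `|x|)%R by rewrite normr_gt0; exact/eqP.
  rewrite /F/= ge0_integralZl//; last first.
    by apply: (measurableT_comp mg); apply: measurable_funM.
  rewrite (@ge0_integral_affine `|x| 0)//.
    congr (_ * _); apply: eq_integral => s _; congr g.
    rewrite /modulus /sqnorm/= addr0 exprMn real_normK ?num_real//.
    rewrite -{1}(mulr1 (x ^+ 2)%R) -mulrDr sqrtrM ?sqr_ge0//.
    by rewrite sqrtr_sqr.
  exact: (measurableT_comp mgm (measurable_pair1 _)).
rewrite -[LHS](@fubini_tonelli1 _ _ _ _ R mu mu)// (@fubini_tonelli2 _ _ _ _ R mu mu)//.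
have k0 x : 0 <= k `|x|%R by rewrite mule_ge0// lee_fin.
have mka : measurable_fun [set: measurableTypeR R] (fun x => k `|x|%R).
  by apply: (measurableT_comp mk); exact: normr_measurable.
pose C := \int[mu]_x k `|x|%R.
transitivity (\int[mu]_s (((oneDsqr s)^-1)%:E * C)).
  apply: eq_integral => s _; rewrite /fubini_G.
  have s0 : (0 < oneDsqr s)%R by rewrite (lt_le_trans _ (oneDsqr_ge1 s)).
  have q0 : (0 < Num.sqrt (oneDsqr s))%R by rewrite sqrtr_gt0.
  rewrite /C (@ge0_integral_affine (Num.sqrt (oneDsqr s)) 0 (fun x => k `|x|%R))//.
  rewrite muleA -EFinM -ge0_integralZl//; last first.
    exact: (measurableT_comp mka (measurable_affine _ _)).
  apply: eq_integral => x _; rewrite /k /F/= addr0 normr_id normrM (gtr0_norm q0).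
  rewrite muleA -EFinM mulrA -(mulrA _^-1%R) -expr2 sqr_sqrtr ?ltW//.
  by rewrite mulVf ?gt_eqF// mul1r (mulrC `|x|%R).
have C0 : 0 <= C by apply: integral_ge0 => x _.
have mo : measurable_fun [set: measurableTypeR R] (fun s : R => ((oneDsqr s)^-1)%:E).
  by apply/measurable_EFinP; apply: continuous_measurable_fun; exact: continuous_oneDsqrV.
have o0 (s : R) : [set: R] s -> 0 <= ((oneDsqr s)^-1)%:E.
  by move=> _; rewrite lee_fin invr_ge0 (le_trans _ (oneDsqr_ge1 s)).
have k0' (x : R) : 0 <= k x by rewrite mule_ge0// lee_fin.
rewrite (ge0_integralZr _ measurableT mo o0 C0).
rewrite integralT_oneDsqr /C (ge0_integral_even mk k0') muleA -EFinM.
have p0 : 0 <= (pi * 2)%:E :> \bar R by rewrite lee_fin mulr_ge0// pi_ge0.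
rewrite -(ge0_integralZl _ _ (measurable_funTS mk) _ p0)//.
apply: eq_integral => x; rewrite inE/= in_itv/= andbT => x0.
by rewrite /k ger0_norm// muleA -EFinM (mulrC pi).
Qed.

End LebesgueChangeOfVariables.
(** * Refining partitions *)

Section FinitePartitions.
Context d (T : measurableType d) (R : realType).
Local Open Scope ereal_scope.

Lemma measure_finType_bigcup (m : {measure set T -> \bar R}) (I : finType)
    (P : pred I) (F : I -> set T) :
  (forall i, measurable (F i)) ->
  (forall i j x, F i x -> F j x -> i = j) ->
  m [set x | exists2 i, P i & F i x] = \sum_(i | P i) m (F i).
Proof.
move=> mF tF.
pose s := [seq i <- index_enum I | P i].
have us : uniq s by rewrite filter_uniq// index_enum_uniq.
have -> : [set x | exists2 i, P i & F i x] = \bigcup_(i in [set` s]) F i.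
  apply/seteqP; split => x /= [i Pi Fi]; exists i => //.
    by rewrite /= mem_filter Pi mem_index_enum.
  by move: Pi; rewrite /= mem_filter => /andP[].
rewrite measure_fin_bigcup//.
- by rewrite -fsbig_seq// big_filter.
- by move=> i j _ _ [x [Fi Fj]]; exact: tF Fi Fj.
Qed.

Variable E : nat -> set T.
Hypothesis mE : forall i, measurable (E i).

(** The cells are the atoms generated by the first [l] sets. Empty ones are kept, so that all levels
    are indexed by a plain finite type. *)
Definition code (l : nat) (x : T) : {ffun 'I_l -> bool} := [ffun i : 'I_l => `[< E i x >]].
Definition cell (l : nat) (c : {ffun 'I_l -> bool}) : set T := [set x | code l x = c].

Lemma measurable_cell l (c : {ffun 'I_l -> bool}) : measurable (cell c).
Proof.
have -> : cell c = \bigcap_(i in [set: 'I_l]) (if c i then E i else ~` E i).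
  apply/seteqP; split => x /=.
    move=> <- i _; rewrite ffunE.
    by case: ifPn => [/asboolP//|/asboolPn].
  move=> h; apply/ffunP => i; rewrite ffunE; have := h i I.
  by case: (c i) => ?; [exact/asboolP|exact/asboolPn].
apply: fin_bigcap_measurable => // i _.
by case: (c i) => //; exact: measurableC.
Qed.

Lemma cell_disjoint l (c c' : {ffun 'I_l -> bool}) x : cell c x -> cell c' x -> c = c'.
Proof. by move=> <- <-. Qed.

Lemma measure_cells (m : {measure set T -> \bar R}) l :
  m setT = \sum_c m (cell (l := l) c).
Proof.
rewrite -measure_finType_bigcup//.
- by congr (m _); apply/seteqP; split => x//= _; exists (code l x).
- exact: measurable_cell.
- exact: cell_disjoint.
Qed.

Lemma measure_cells_coord (m : {measure set T -> \bar R}) l (i : 'I_l) :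
  m (E i) = \sum_(c : {ffun 'I_l -> bool} | c i) m (cell c).
Proof.
rewrite -measure_finType_bigcup//.
- congr (m _); apply/seteqP; split => x/=.
    by move=> Ex; exists (code l x) => //; rewrite ffunE; exact/asboolP.
  by move=> [c ci cx]; move: ci; rewrite -cx ffunE => /asboolP.
- exact: measurable_cell.
- exact: cell_disjoint.
Qed.

Hypothesis sepE : forall x y, (forall i, E i x <-> E i y) -> x = y.

Lemma nonincreasing_cells x : nonincreasing_seq (fun l => cell (code l x)).
Proof.
move=> l l' ll'; apply/subsetPset => y /= yx; apply/ffunP => i.
have := congr1 (fun f : {ffun _ -> bool} => f (widen_ord ll' i)) yx.
by rewrite !ffunE.
Qed.

Lemma bigcap_cells x : \bigcap_l cell (code l x) = [set x].
Proof.
apply/seteqP; split => y /=; last by move=> -> l _.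
move=> h; apply: sepE => i.
have := congr1 (fun f : {ffun _ -> bool} => f (ord_max : 'I_i.+1)) (h i.+1 I).
rewrite !ffunE /= => e.
by rewrite -(asboolE (E i x)) -(asboolE (E i y)) e.
Qed.

(** Presents the measure of the cell around [x] as a step function of [x], from which its
    measurability and its integral are read off. *)
Lemma cell_measure_indic (m : {measure set T -> \bar R}) l x :
  m (cell (code l x)) = \sum_(c : {ffun 'I_l -> bool}) m (cell c) * (\1_(cell c) x)%:E.
Proof.
rewrite (bigD1 (code l x))//= big1 ?adde0.
  by rewrite indicE mem_set// mule1.
move=> c cx; rewrite indicE memNset ?mule0// => xc.
by move: cx; rewrite -xc eqxx.
Qed.

Lemma measurable_cell_measure (m : {measure set T -> \bar R}) l :
  measurable_fun setT (fun x => m (cell (code l x))).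
Proof.
under eq_fun do rewrite cell_measure_indic.
apply: emeasurable_sum => c.
apply: emeasurable_funM => //; apply/measurable_EFinP.
by apply: measurable_indic; exact: measurable_cell.
Qed.

Lemma integral_cell_measure (m1 m2 : {measure set T -> \bar R}) l :
  \int[m1]_x m2 (cell (code l x)) = \sum_(c : {ffun 'I_l -> bool}) m2 (cell c) * m1 (cell c).
Proof.
under eq_integral do rewrite cell_measure_indic.
have mI (c : {ffun 'I_l -> bool}) :
    measurable_fun setT (fun x => m2 (cell c) * (\1_(cell c) x)%:E).
  apply: emeasurable_funM => //; apply/measurable_EFinP.
  by apply: measurable_indic; exact: measurable_cell.
rewrite ge0_integral_sum//; try by move=> c x _; rewrite mule_ge0// lee_fin.
apply: eq_bigr => c _; rewrite ge0_integralZl//.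
- by rewrite integral_indic ?setIT//; exact: measurable_cell.
- by apply/measurable_EFinP/measurable_indic; exact: measurable_cell.
Qed.

(* The left-hand side is the integral of [m2 (cell (code l x))] against [m1],
   and the cell around [x] decreases to [x]. *)
Lemma cvg_cells_product (m1 m2 : {measure set T -> \bar R}) :
  m1 setT < +oo -> m2 setT < +oo ->
  (fun l => \sum_(c : {ffun 'I_l -> bool}) m2 (cell c) * m1 (cell c)) @ \oo -->
  \int[m1]_x m2 [set x].
Proof.
move=> m1fin m2fin.
under eq_fun do rewrite -integral_cell_measure.
have m2fin' : m2 setT \is a fin_num by rewrite ge0_fin_numE.
have cvg_pt x : (fun l => m2 (cell (code l x))) @ \oo --> m2 [set x].
  rewrite -bigcap_cells; apply: nonincreasing_cvg_mu.
  - apply: le_lt_trans m2fin; apply: le_measure; rewrite ?inE//.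
    exact: measurable_cell.
  - by move=> l; exact: measurable_cell.
  - by apply: bigcap_measurable => // k _; exact: measurable_cell.
  - exact: nonincreasing_cells.
have [] // := @dominated_convergence _ T R m1 setT measurableT
  (fun l x => m2 (cell (code l x))) (fun x => m2 [set x]) (cst (m2 setT)).
- by move=> l; exact: measurable_cell_measure.
- apply: (emeasurable_fun_cvg (fun l x => m2 (cell (code l x)))) => //.
  by move=> l; exact: measurable_cell_measure.
- by apply: aeW => x _; exact: cvg_pt.
- apply/integrableP; split => //.
  by under eq_integral do rewrite /= gee0_abs//; rewrite integral_cst// lte_mul_pinfty.
- apply: aeW => x l _; rewrite gee0_abs//.
  by apply: le_measure; rewrite ?inE//; exact: measurable_cell.
Qed.

(** The sum of the squared cell masses tends to the integral of [m [set x]] against [m], which is at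
    most [m setT] as atoms have mass at most 1. The masses are integers, so a cell of mass [k >= 2],
    with [k * k >= k + 1], would keep that sum at least [m setT + 1]; at a fine level this is
    impossible. *)
Lemma simple_cells (m : {measure set T -> \bar R}) :
  (forall B, measurable B -> (exists n : nat, m B = n%:R%:E) \/ m B = +oo) ->
  m setT < +oo -> (forall x, m [set x] <= 1) ->
  exists l, forall c : {ffun 'I_l -> bool}, m (cell c) <= 1.
Proof.
move=> natm mfin m1.
have mc l : forall c : {ffun 'I_l -> bool}, exists n : nat, m (cell c) = n%:R%:E.
  move=> c; case: (natm (cell c) (measurable_cell c)) => // moo.
  have : m (cell c) <= m setT.
    by apply: le_measure; rewrite ?inE//; exact: measurable_cell.
  by rewrite moo leye_eq => /eqP h; rewrite h in mfin.
have mfin' : m setT \is a fin_num by rewrite ge0_fin_numE.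
have lim_le : \int[m]_x m [set x] <= m setT.
  rewrite -[leRHS]mul1e -integral_cst//; apply: ge0_le_integral => //.
  apply: (emeasurable_fun_cvg (fun l x => m (cell (code l x)))) => //.
  - by move=> l; exact: measurable_cell_measure.
  - move=> x _; rewrite -bigcap_cells; apply: nonincreasing_cvg_mu.
    + apply: le_lt_trans mfin; apply: le_measure; rewrite ?inE//.
      exact: measurable_cell.
    + by move=> l; exact: measurable_cell.
    + by apply: bigcap_measurable => // k _; exact: measurable_cell.
    + exact: nonincreasing_cells.
have lim_lt : \int[m]_x m [set x] < m setT + 1.
  by apply: le_lt_trans lim_le _; rewrite lteDl ?lte_fin.
have /(_ _ lim_lt)[l _ /(_ l (leqnn l))/= hl] :
    forall y, \int[m]_x m [set x] < y ->
    \forall l \near \oo, \sum_(c : {ffun 'I_l -> bool}) m (cell c) * m (cell c) < y.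
  by move=> y /open_ereal_lt'; exact: (cvg_cells_product mfin mfin).
exists l => c.
have [n nE] := mc l c; rewrite leNgt nE; apply/negP => n1.
move: hl; apply/negP; rewrite -leNgt (measure_cells m l).
rewrite (bigD1 c)//= [leRHS](bigD1 c)//= addeAC leeD//.
  rewrite nE -EFinM -EFinD lee_fin -natrM -[1%R]/(1%:R)%R -natrD ler_nat.
  move: n1; rewrite lte_fin ltr1n => n1.
  by rewrite addn1 ltn_Pmulr// ltnW.
apply: lee_sum => c' _; have [n' ->] := mc l c'.
by rewrite -EFinM lee_fin -natrM ler_nat; case: n' => // n'; rewrite leq_pmulr.
Qed.

End FinitePartitions.
Section CellMass.
Context d (T : measurableType d) (R : realType).
Local Open Scope ereal_scope.

(** At a level where every cell has mass 0 or 1, the total mass is the number of occupied cells, and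
    the product over these cells is 1; so there cannot be more than [n] of them. *)
Lemma mass_le_cells (E : nat -> set T) (mE : forall i, measurable (E i))
    (sepE : forall x y, (forall i, E i x <-> E i y) -> x = y)
    (m : {measure set T -> \bar R}) (n : nat) :
  (forall B, measurable B -> (exists n : nat, m B = n%:R%:E) \/ m B = +oo) ->
  m setT < +oo -> (forall x, m [set x] <= 1) ->
  (forall l (S : {set {ffun 'I_l -> bool}}), (n < #|S|)%N ->
    \prod_(c in S) m (cell E c) = 0) ->
  m setT <= n%:R%:E.
Proof.
move=> natm mfin m1 prod0.
have [l hl] := simple_cells mE sepE natm mfin m1.
have mc (c : {ffun 'I_l -> bool}) : m (cell E c) = (m (cell E c) != 0)%:R%:E.
  have := hl c; case: (natm (cell E c) (measurable_cell mE c)) => [[k ->]|->//].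
  rewrite lee_fin -[1%R]/(1%:R)%R ler_nat => k1; rewrite eqe pnatr_eq0; congr (_%:R%:E).
  by case: k k1 => [|[]].
pose S := [set c : {ffun 'I_l -> bool} | m (cell E c) != 0]%SET.
have mS : m setT = #|S|%:R%:E.
  rewrite (measure_cells mE m l) (eq_bigr (fun c => (c \in S)%:R%:E)).
    by rewrite sumEFin -natr_sum -sum1_card [in RHS]big_mkcond.
  by move=> c _; rewrite mc inE.
rewrite mS lee_fin ler_nat leqNgt; apply/negP => /prod0.
rewrite big1; last by move=> c; rewrite inE => h; rewrite mc h.
by move/eqP; rewrite onee_eq0.
Qed.

End CellMass.

(** * Configurations of occupied cells *)

Lemma emeasurable_prod d (T : measurableType d) (R : realType) (I : Type)
    (s : seq I) (p : pred I) (h : I -> T -> \bar R) :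
  (forall i, measurable_fun setT (h i)) ->
  measurable_fun setT (fun x => \prod_(i <- s | p i) h i x)%E.
Proof.
move=> mh; elim: s => [|i s ih]; first by under eq_fun do rewrite big_nil; exact: measurable_cst.
under eq_fun do rewrite big_cons.
by case: (p i) => //; exact: emeasurable_funM.
Qed.

Section Configurations.
Variables (R : realType) (C : finType).
Local Open Scope ereal_scope.

(** The counts dominate the indicator of [S] termwise and have the same sum, so every term is an
    equality. *)
Lemma sumn_eq_card (X : C -> nat) (S : {set C}) :
  (\sum_c X c = #|S|)%N -> (forall c, c \in S -> (0 < X c)%N) ->
  forall c, X c = (c \in S).
Proof.
move=> sX X0 c; apply/esym/eqP.
have e : (#|S| = \sum_c (c \in S : nat))%N by rewrite -sum1_card big_mkcond.
have H i : true -> ((i \in S : nat) <= X i ?= iff ((i \in S : nat) == X i))%N.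
  by move=> _; split => //; case: (boolP (i \in S)) => // /X0.
have [_] := leqif_sum H.
by rewrite sX -e eqxx => /esym/forallP/(_ c).
Qed.

(* If the counts sum to [#|S|] and no cell of [S] is empty, then every cell of
   [S] holds exactly one point and the other cells are empty. *)
Lemma prod_configuration (x : C -> \bar R) (S : {set C}) :
  (forall c, exists k : nat, x c = k%:R%:E) -> \sum_c x c = #|S|%:R%:E ->
  \prod_(c in S) x c = (\1_[set y : C -> \bar R | forall c, y c = (c \in S)%:R%:E] x)%:E.
Proof.
move=> /choice[X xX] sx; rewrite indicE.
have sX : (\sum_c X c = #|S|)%N.
  apply/eqP; rewrite -(eqr_nat R) natr_sum -eqe -sumEFin -sx; apply/eqP.
  by apply: eq_bigr => c _; rewrite xX.
case: (boolP [forall c in S, 0 < X c]%N) => [/forall_inP X0|].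
  have XS := sumn_eq_card sX X0.
  by rewrite mem_set/= => [|c]; rewrite ?xX ?XS// big1// => c cS; rewrite xX XS cS.
rewrite negb_forall_in => /existsP[c /andP[cS]]; rewrite -eqn0Ngt => /eqP X0.
rewrite (bigD1 c)//= xX X0 mul0e memNset//= => /(_ c)/eqP.
by rewrite xX X0 cS eqe (eqr_nat R).
Qed.

Context d (Omega : measurableType d) (P : probability Omega R).
Variable x : Omega -> C -> \bar R.
Hypothesis mx : forall c, measurable_fun setT (x ^~ c).

Definition config_event (S : {set C}) : set Omega :=
  [set w | forall c, x w c = (c \in S)%:R%:E].

Lemma measurable_config_event S : measurable (config_event S).
Proof.
have -> : config_event S =
    \bigcap_(c in [set: C]) (x ^~ c @^-1` [set (c \in S)%:R%:E]).
  by apply/seteqP; split => w /= h c => [_|]; exact: h.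
apply: fin_bigcap_measurable => // c _; rewrite -[X in measurable X]setTI.
exact: mx.
Qed.

Lemma config_event_inj S S' w : config_event S w -> config_event S' w -> S = S'.
Proof.
move=> h h'; apply/setP => c; move: (h c); rewrite h' => /eqP; rewrite eqe eqr_nat.
by do 2 case: (c \in _).
Qed.

(** If [S] has [n] elements, the product over [S] is almost surely the indicator of the
    configuration; otherwise the configuration contradicts the total count. *)
Lemma probability_config_event n S :
  {ae P, forall w, (forall c, exists k : nat, x w c = k%:R%:E) /\
                   \sum_c x w c = n%:R%:E} ->
  P (config_event S) =
    if #|S| == n then \int[P]_w \prod_(c in S) x w c else 0.
Proof.
move=> aex; case: eqP => [Sn|Sn].
  have -> : P (config_event S) = \int[P]_w (\1_(config_event S) w)%:E.
    by rewrite integral_indic ?setIT//; exact: measurable_config_event.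
  apply: ae_eq_integral => //.
  - by apply/measurable_EFinP/measurable_indic; exact: measurable_config_event.
  - exact: emeasurable_prod.
  - apply: filterS aex => w [xnat sx] _; rewrite prod_configuration ?sx ?Sn//.
apply: measure_negligible; first exact: measurable_config_event.
apply: negligibleS aex => w /= Sw [_ sx]; apply: Sn.
move: sx; rewrite (eq_bigr (fun c => (c \in S)%:R%:E)) => [|c _]; last exact: Sw.
rewrite sumEFin -natr_sum => /eqP; rewrite eqe eqr_nat => /eqP <-.
by rewrite -sum1_card [in LHS]big_mkcond.
Qed.

Variables (m : nat) (sel : 'I_m -> pred C) (k : 'I_m -> nat).

(** Decides from the configuration alone whether the prescribed counts hold; [sel i] selects the
    cells that make up the [i]-th set. *)
Definition config_ok (S : {set C}) := [forall i, #|[set c in S | sel i c]%SET| == k i].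

Definition count_event : set Omega :=
  [set w | forall i, \sum_(c | sel i c) x w c = (k i)%:R%:E].

Lemma config_ok_count S w : config_event S w -> count_event w <-> config_ok S.
Proof.
move=> Sw.
have e i : \sum_(c | sel i c) x w c = #|[set c in S | sel i c]%SET|%:R%:E.
  rewrite (eq_bigr (fun c => (c \in S)%:R%:E)); last by move=> c _; exact: Sw.
  rewrite sumEFin -natr_sum -sum1_card big_mkcond [in RHS]big_mkcond/=.
  congr (_%:R%:E); apply: eq_bigr => c _; rewrite inE.
  by case: (c \in S); case: (sel i c).
split => [h|/forallP h i]; last by rewrite e; have /eqP -> := h i.
apply/forallP => i; have /eqP := h i.
by rewrite e eqe eqr_nat.
Qed.

Lemma measurable_count_event : measurable count_event.
Proof.
have -> : count_event = \bigcap_(i in [set: 'I_m])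
    ((fun w => \sum_(c | sel i c) x w c) @^-1` [set (k i)%:R%:E]).
  by apply/seteqP; split => w /= h i => [_|]; exact: h.
have ms i : measurable_fun setT (fun w => \sum_(c | sel i c) x w c).
  under eq_fun do rewrite big_mkcond.
  by apply: emeasurable_sum => c; case: (sel i c).
apply: fin_bigcap_measurable => // i _; rewrite -[X in measurable X]setTI.
exact: ms.
Qed.

(** The configuration events are disjoint and each of them decides the count event. Only outcomes in
    no configuration are undecided, and these have the probability added in the upper bound. *)
Lemma count_event_bounds :
  \sum_(S | config_ok S) P (config_event S) <= P count_event <=
  \sum_(S | config_ok S) P (config_event S) + (1 - \sum_S P (config_event S)).
Proof.
pose G (p : pred {set C}) := [set w | exists2 S, p S & config_event S w].
have PG p : P (G p) = \sum_(S | p S) P (config_event S).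
  by apply: measure_finType_bigcup; [exact: measurable_config_event|exact: config_event_inj].
have mG p : measurable (G p).
  have -> : G p = \bigcup_(S in [set` p]) config_event S.
    by apply/seteqP; split => w /= [S]; exists S.
  by apply: fin_bigcup_measurable => // S _; exact: measurable_config_event.
have mEv := measurable_count_event.
rewrite -!PG; apply/andP; split.
  apply: le_measure; rewrite ?inE// => w [S okS Sw].
  exact/(config_ok_count Sw).
rewrite -probability_setC//.
apply: (le_trans (y := P (G config_ok `|` ~` G xpredT))).
  apply: le_measure; rewrite ?inE//.
    by apply: measurableU => //; exact: measurableC.
  move=> w Ew; case: (pselect (G xpredT w)) => [[S _ Sw]|]; last by right.
  by left; exists S => //; exact/(config_ok_count Sw).
by apply: measureU2 => //; exact: measurableC.
Qed.

End Configurations.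

(** * Complex-valued functions on the plane *)

Section ComplexValued.
Variable R : realType.
Implicit Types (w v : R[i]).

Lemma ReM w v : complex.Re (w * v) = complex.Re w * complex.Re v - complex.Im w * complex.Im v.
Proof. by case: w; case: v. Qed.

Lemma ImM w v : complex.Im (w * v) = complex.Re w * complex.Im v + complex.Im w * complex.Re v.
Proof. by case: w; case: v. Qed.

Lemma ReD w v : complex.Re (w + v) = complex.Re w + complex.Re v.
Proof. by case: w; case: v. Qed.

Lemma Re_sum (I : Type) (s : seq I) (P : pred I) (F : I -> R[i]) :
  complex.Re (\sum_(i <- s | P i) F i) = \sum_(i <- s | P i) complex.Re (F i).
Proof. by apply: (big_morph _ ReD). Qed.

Lemma Re_conjc w : complex.Re (conjc w) = complex.Re w. Proof. by case: w. Qed.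

Lemma Im_conjc w : complex.Im (conjc w) = - complex.Im w. Proof. by case: w. Qed.

Lemma conjcM w v : conjc (w * v) = conjc w * conjc v.
Proof. exact: rmorphM. Qed.

Lemma complex_eq w v :
  complex.Re w = complex.Re v -> complex.Im w = complex.Im v -> w = v.
Proof. by case: w v => a b [c d] /= -> ->. Qed.

Definition sqnormc w : R := complex.Re w ^+ 2 + complex.Im w ^+ 2.

Lemma sqnormcM w v : sqnormc (w * v) = sqnormc w * sqnormc v.
Proof. by rewrite /sqnormc ReM ImM; ring. Qed.

Lemma sqnormc1 : sqnormc 1 = 1.
Proof. by rewrite /sqnormc /= expr0n addr0 expr1n. Qed.

Lemma sqnormcX w n : sqnormc (w ^+ n) = sqnormc w ^+ n.
Proof. by elim: n => [|n ih]; rewrite ?sqnormc1// !exprS sqnormcM ih. Qed.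

Lemma sqnormc_conj w : sqnormc (conjc w) = sqnormc w.
Proof. by rewrite /sqnormc Re_conjc Im_conjc sqrrN. Qed.

Lemma sqnormc_real (x : R) : sqnormc x%:C%C = x ^+ 2.
Proof. by rewrite /sqnormc /= expr0n addr0. Qed.

Lemma mul_conjc w : w * conjc w = (sqnormc w)%:C%C.
Proof.
apply: complex_eq; rewrite ?ReM ?ImM Re_conjc Im_conjc /sqnormc /=; ring.
Qed.

Definition cmeasurable (f : R * R -> R[i]) : Prop :=
  measurable_fun setT (fun z => complex.Re (f z)) /\
  measurable_fun setT (fun z => complex.Im (f z)).

Lemma cmeasurableM f g : cmeasurable f -> cmeasurable g ->
  cmeasurable (fun z => f z * g z).
Proof.
move=> [f1 f2] [g1 g2]; split.
  by under eq_fun do rewrite ReM; apply: measurable_funB; apply: measurable_funM.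
by under eq_fun do rewrite ImM; apply: measurable_funD; apply: measurable_funM.
Qed.

Lemma cmeasurable_conj f : cmeasurable f -> cmeasurable (fun z => conjc (f z)).
Proof.
move=> [f1 f2]; split; first by under eq_fun do rewrite Re_conjc.
under eq_fun do rewrite Im_conjc.
exact: (measurableT_comp (@oppr_measurable R setT)).
Qed.

Lemma cmeasurable_real (f : R * R -> R) : measurable_fun setT f ->
  cmeasurable (fun z => (f z)%:C%C).
Proof. by move=> mf; split => //=; exact: measurable_cst. Qed.

Lemma cmeasurableX f n : cmeasurable f -> cmeasurable (fun z => f z ^+ n).
Proof.
move=> mf; elim: n => [|n ih]; first by split => /=; exact: measurable_cst.
by under eq_fun do rewrite exprS; exact: cmeasurableM.
Qed.

Lemma cmeasurable_toC : cmeasurable (@toC R).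
Proof. by split => /=; [exact: measurable_fst|exact: measurable_snd]. Qed.

Lemma cmeasurable_sqnormc f : cmeasurable f ->
  measurable_fun setT (fun z => sqnormc (f z)).
Proof. by move=> [? ?]; apply: measurable_funD; exact: measurable_funX. Qed.

Lemma cos_sin_exp (t : R) n :
  (Complex (cos t) (sin t)) ^+ n = Complex (cos (t *+ n)) (sin (t *+ n)).
Proof.
elim: n => [|n ih]; first by rewrite mulr0n cos0 sin0.
by apply: complex_eq; rewrite exprS ih ?ReM ?ImM/= mulrS ?cosD ?sinD; ring.
Qed.

(** For [a < b], the angle [pi / (2 (b - a))] makes the quotient of the two powers equal to [i]. It
    is at most [pi / 2], so its cosine is nonnegative and the half-turn, excluded by
    [ge0_integral_rotation], is avoided. *)
Lemma unit_expr_neq (a b : nat) : a <> b ->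
  exists c s : R, [/\ c ^+ 2 + s ^+ 2 = 1, c != -1 &
    (Complex c s) ^+ a <> (Complex c s) ^+ b].
Proof.
wlog ab : a b / (a < b)%N.
  move=> h /eqP; rewrite neq_ltn => /orP[|] ab.
    by apply: h => //; apply/eqP; rewrite neq_ltn ab.
  have [|c [s [h1 h2 h3]]] := h b a ab; first by apply/eqP; rewrite neq_ltn ab.
  by exists c, s; split => // /esym.
move=> _; pose t : R := pi / 2 / (b - a)%:R.
have d0 : 0 < (b - a)%:R :> R by rewrite ltr0n subn_gt0.
have t0 : 0 <= t by rewrite !divr_ge0// ?pi_ge0// ltW.
have t1 : t <= pi / 2.
  by rewrite ler_pdivrMr// ler_peMr ?divr_ge0 ?pi_ge0// ler1n subn_gt0.
exists (cos t), (sin t); split.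
- exact: cos2Dsin2.
- apply/eqP => ct; have : 0 <= cos t.
    apply: cos_ge0_pihalf; rewrite t1 andbT (le_trans _ t0)//.
    by rewrite oppr_le0 divr_ge0// pi_ge0.
  by rewrite ct; lra.
- rewrite -(subnK (ltnW ab)) exprD => /(congr1 (fun w => w * conjc (Complex (cos t) (sin t) ^+ a))).
  rewrite -mulrA mul_conjc sqnormcX {1 2}/sqnormc/= cos2Dsin2 expr1n mulr1 cos_sin_exp.
  rewrite -mulr_natr /t divfK ?gt_eqF// cos_pihalf sin_pihalf => -[].
  by move/eqP; rewrite oner_eq0.
Qed.

End ComplexValued.

(** * Hermite functions *)

Section Hermite.
Variable R : realType.

(** The first [d] terms on the left have a vanishing binomial coefficient, and the others match
    termwise. This reconciles [densY], which uses the parameter [j - r] for all [j], with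
    [hermiteC], which switches to [r - j] when [j <= r]. *)
Lemma laguerre_negative (j d : nat) (y : R) :
  laguerre (j + d) (j%:Z - (j + d)%:Z) y =
  (- y) ^+ d * (j`!)%:R / ((j + d)`!)%:R * laguerre j ((j + d)%:Z - j%:Z) y.
Proof.
rewrite /laguerre.
have -> : (j + d)%:Z + (j%:Z - (j + d)%:Z) = j by rewrite addrC subrK.
have -> : j%:Z + ((j + d)%:Z - j%:Z) = (j + d)%N by rewrite addrC subrK.
rewrite (addnC j d) -addnS big_split_ord /= big1 ?add0r; last first.
  move=> i _; rewrite bin_small ?mulr0 ?mul0r//=.
  by rewrite ltn_subRL ltn_add2r.
rewrite mulr_sumr; apply: eq_bigr => -[l lj] _ /=.
rewrite subnDl.
have lj' : (l <= j)%N by rewrite -ltnS.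
have f0 k : (k`!)%:R != 0 :> R by rewrite pnatr_eq0 -lt0n fact_gt0.
have e1 : ('C(j, j - l))%:R = (j`!)%:R / (((j - l)`!)%:R * (l`!)%:R) :> R.
  apply/(canRL (mulfK _)); first by rewrite mulf_neq0.
  by rewrite -!natrM; have := bin_fact (leq_subr l j); rewrite subKn// => ->.
have e2 : ('C(d + j, j - l))%:R = ((d + j)`!)%:R / (((j - l)`!)%:R * ((d + l)`!)%:R) :> R.
  apply/(canRL (mulfK _)); first by rewrite mulf_neq0.
  rewrite -!natrM; have := bin_fact (leq_trans (leq_subr l j) (leq_addl d j)).
  by rewrite -addnBA ?leq_subr// subKn// => ->.
rewrite e1 e2 !exprD (exprNn y).
by field; rewrite !f0.
Qed.

Definition phi (r j : nat) (z : R * R) : R[i] :=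
  (expR (- (pi / 2) * sqnorm z))%:C%C * hermiteC j r z.

Lemma kernelK_phi r (J : seq nat) z z' :
  kernelK r J z z' = \sum_(j <- J) phi r j z * conjc (phi r j z').
Proof.
rewrite /kernelK mulr_sumr; apply: eq_bigr => j _.
rewrite mulrDr expRD [(_ * _)%:C%C]rmorphM /phi conjcM conjc_real.
by rewrite mulrACA.
Qed.

Lemma cmeasurable_phi r j : cmeasurable (phi r j).
Proof.
have msq : measurable_fun setT (@sqnorm R) := @measurable_sqnorm R.
have mlag k a : measurable_fun setT (fun z : R * R => laguerre k a (pi * sqnorm z)).
  apply: measurable_sum => i; apply: measurable_funM => //.
  apply: measurable_funM => //; apply: measurable_funX.
  exact: measurable_funM.
apply: cmeasurableM.
  apply: cmeasurable_real; apply: measurableT_comp => //.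
  exact: measurable_funM.
rewrite /hermiteC; case: (r < j)%N; apply: cmeasurableM.
- by apply: cmeasurable_real; apply: measurable_funM.
- exact/cmeasurableX/cmeasurable_toC.
- by apply: cmeasurable_real; apply: measurable_funM.
- exact/cmeasurableX/cmeasurable_conj/cmeasurable_toC.
Qed.

(** The squared modulus of [phi r j] as a function of the modulus of its argument, with natural
    exponents only. *)
Definition radial_phi (r j : nat) (x : R) : R :=
  expR (- pi * x ^+ 2) *
  if (r < j)%N then
    (r`!)%:R / (j`!)%:R * pi ^+ (j - r)
    * laguerre r (j%:Z - r%:Z) (pi * x ^+ 2) ^+ 2 * (x ^+ 2) ^+ (j - r)
  else
    (j`!)%:R / (r`!)%:R * pi ^+ (r - j)
    * laguerre j (r%:Z - j%:Z) (pi * x ^+ 2) ^+ 2 * (x ^+ 2) ^+ (r - j).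

Lemma radial_phi_ge0 r j x : 0 <= radial_phi r j x.
Proof.
rewrite /radial_phi mulr_ge0 ?expR_ge0//.
have pin n : 0 <= pi ^+ n :> R by rewrite exprn_ge0// pi_ge0.
have x2n n : 0 <= (x ^+ 2) ^+ n by rewrite exprn_ge0// sqr_ge0.
by case: ifP => _; apply: (mulr_ge0 (mulr_ge0 (mulr_ge0 _ (pin _)) (sqr_ge0 _)) (x2n _));
  rewrite divr_ge0.
Qed.

Lemma measurable_radial_phi r j : measurable_fun [set: R] (radial_phi r j).
Proof.
have mx2 : measurable_fun [set: R] (fun x : R => x ^+ 2) by exact: measurable_funX.
have mlag k a : measurable_fun [set: R] (fun x : R => laguerre k a (pi * x ^+ 2)).
  apply: measurable_sum => i; apply: measurable_funM => //.
  apply: measurable_funM => //; apply: measurable_funX.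
  exact: measurable_funM.
apply: measurable_funM.
  by apply: measurableT_comp => //; exact: measurable_funM.
case: (r < j)%N; apply: measurable_funM; try exact: measurable_funX.
  by apply: measurable_funM => //; exact: measurable_funX.
by apply: measurable_funM => //; exact: measurable_funX.
Qed.

Lemma sqr_modulus (z : R * R) : modulus z ^+ 2 = sqnorm z.
Proof. by rewrite sqr_sqrtr// addr_ge0 ?sqr_ge0. Qed.

Lemma sqnormc_phi r j (z : R * R) : sqnormc (phi r j z) = radial_phi r j (modulus z).
Proof.
rewrite /phi sqnormcM sqnormc_real /radial_phi sqr_modulus -expRM_natl.
congr (expR _ * _); first by field.
have fr (a b : nat) : 0 <= (a`!)%:R / (b`!)%:R :> R by rewrite divr_ge0.
have sq : sqnormc (toC z) = sqnorm z by [].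
have sp : Num.sqrt pi ^+ 2 = pi :> R by rewrite sqr_sqrtr// pi_ge0.
rewrite /hermiteC; case: ifP => _; rewrite sqnormcM sqnormc_real sqnormcX ?sqnormc_conj sq.
  by rewrite !exprMn -exprM mulnC exprM sp sqr_sqrtr.
by rewrite !exprMn sqrr_sign mul1r -(exprM (Num.sqrt pi)) mulnC exprM sp sqr_sqrtr.
Qed.

(** The factor [2 * pi * x] is the one of polar coordinates; when [j <= r], the match goes through
    [laguerre_negative]. *)
Lemma radial_phi_densY r j x : 0 <= x -> 2 * pi * x * radial_phi r j x = densY r j x.
Proof.
rewrite le_eqVlt => /predU1P[<-|x0].
  (* At [x = 0] the integer exponent [2 (j - r) + 1] may be negative, but it is odd, hence nonzero,
     and the power of 0 is 0. *)
  rewrite mulr0 mul0r /densY lexx exp0rz (_ : (_ == 0) = false) ?mulr0 ?mul0r//.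
  apply/eqP; lia.
rewrite /densY (ltW x0) /radial_phi.
have xN0 : x != 0 by rewrite gt_eqF.
have p0 : pi != 0 :> R by rewrite gt_eqF// pi_gt0.
have f0 k : (k`!)%:R != 0 :> R by rewrite pnatr_eq0 -lt0n fact_gt0.
case: ltnP => [/ltnW|] rj.
  have [d jE] : exists d, j = (r + d)%N by exists (j - r)%N; rewrite subnKC.
  subst j; rewrite addKn; set L := laguerre _ _ _.
  have -> : pi ^ ((r + d)%N%:Z - r%:Z + 1) = pi * pi ^+ d :> R.
    rewrite (_ : (r + d)%N%:Z - r%:Z + 1 = d.+1%:Z); last by lia.
    by rewrite -exprnP exprS.
  have -> : x ^ (2 * ((r + d)%N%:Z - r%:Z) + 1) = x * (x ^+ 2) ^+ d.
    rewrite (_ : 2 * ((r + d)%N%:Z - r%:Z) + 1 = (2 * d).+1%:Z); last by lia.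
    by rewrite -exprnP exprS exprM.
  by rewrite mulNr; field.
have [d rE] : exists d, r = (j + d)%N by exists (r - j)%N; rewrite subnKC.
subst r; rewrite addKn laguerre_negative; set L := laguerre _ _ _.
have -> : pi ^ (j%:Z - (j + d)%N%:Z + 1) = pi / pi ^+ d :> R.
  rewrite (_ : _ + 1 = 1 - d%:Z); last by lia.
  by rewrite expfzDr// expr1z -exprnN.
have -> : x ^ (2 * (j%:Z - (j + d)%N%:Z) + 1) = x / (x ^+ 2) ^+ d.
  rewrite (_ : _ + 1 = 1 - (2 * d)%N%:Z); last by lia.
  by rewrite expfzDr// expr1z -exprnN exprM.
have e : (- (pi * x ^+ 2)) ^+ d * (- (pi * x ^+ 2)) ^+ d =
    pi ^+ d * pi ^+ d * ((x ^+ 2) ^+ d * (x ^+ 2) ^+ d).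
  by rewrite -!exprMn; congr (_ ^+ _); ring.
transitivity (2 * (pi / pi ^+ d) * (j + d)`!%:R / j`!%:R * (x / (x ^+ 2) ^+ d)
  * ((- (pi * x ^+ 2)) ^+ d * (- (pi * x ^+ 2)) ^+ d * (j`!%:R / (j + d)`!%:R) ^+ 2 * L ^+ 2)
  * expR (- pi * x ^+ 2)).
  by rewrite e; field; rewrite !f0 !expf_neq0.
by field; rewrite !f0 !expf_neq0.
Qed.

End Hermite.

(** * Integrals over annuli *)

Lemma measurable_funT_restrict d (T : measurableType d) (R : realType) (D : set T)
    (f : T -> \bar R) :
  measurable D -> measurable_fun setT f -> measurable_fun setT (f \_ D).
Proof. by move=> mD mf; apply/(measurable_restrictT f mD); exact: measurable_funTS. Qed.

Section RadialIntegrals.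
Variable R : realType.
Local Notation mu := (@lebesgue_measure R).
Local Notation leb2 := (@leb2 R).
Implicit Types (f g : R * R -> R[i]) (A : set (R * R)) (B : set R).

(** As [fine] sends infinite values to 0, this is the complex integral only under [cintegrable]. *)
Definition cint A f : R[i] :=
  Complex (fine (\int[leb2]_(z in A) (complex.Re (f z))%:E)%E)
          (fine (\int[leb2]_(z in A) (complex.Im (f z))%:E)%E).

Definition cintegrable A f : Prop :=
  leb2.-integrable A (fun z => (complex.Re (f z))%:E) /\
  leb2.-integrable A (fun z => (complex.Im (f z))%:E).

Lemma integrable_ReM A (b : R[i]) f : measurable A -> cintegrable A f ->
  leb2.-integrable A (fun z => (complex.Re (b * f z))%:E).
Proof.
move=> mA [f1 f2].
under eq_fun do rewrite ReM EFinB !EFinM.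
by apply: integrableB => //; apply: integrableZl.
Qed.

Lemma integral_ReM A (b : R[i]) f : measurable A -> cintegrable A f ->
  (\int[leb2]_(z in A) (complex.Re (b * f z))%:E = (complex.Re (b * cint A f))%:E)%E.
Proof.
move=> mA [f1 f2].
under eq_integral do rewrite ReM EFinB !EFinM.
rewrite integralB//; try by apply: integrableZl.
rewrite !integralZl// ReM /cint/= EFinB !EFinM !fineK//; exact: integrable_fin_num.
Qed.

Lemma cintZ A (b : R[i]) f : measurable A -> cintegrable A f ->
  cint A (fun z => b * f z) = b * cint A f.
Proof.
move=> mA fA; apply: complex_eq.
  by rewrite [LHS]/= integral_ReM.
(* The imaginary part of a number is the real part of its product with [-i], so [integral_ReM]
   serves again. *)
rewrite [LHS]/= (_ : complex.Im (b * cint A f) =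
  complex.Re ((b * Complex 0 (-1)) * cint A f)); last by rewrite !(ReM, ImM)/=; ring.
rewrite -[RHS]/(fine (_)%:E) -integral_ReM//; congr fine.
by apply: eq_integral => z _; rewrite !(ReM, ImM)/=; congr EFin; ring.
Qed.

Lemma integral_rotation (c s : R) (f : R * R -> \bar R) :
  c ^+ 2 + s ^+ 2 = 1 -> c != -1 -> measurable_fun setT f ->
  (\int[leb2]_z f ((c * z.1 - s * z.2)%R, (s * z.1 + c * z.2)%R) = \int[leb2]_z f z)%E.
Proof.
move=> cs c1 mf.
pose rot (z : R * R) : R * R := ((c * z.1 - s * z.2)%R, (s * z.1 + c * z.2)%R).
rewrite -[LHS]/(\int[leb2]_z (f \o rot) z)%E integralE [RHS]integralE.
rewrite funepos_comp funeneg_comp; congr (_ - _)%E; apply: ge0_integral_rotation => //.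
  exact: measurable_funepos.
exact: measurable_funeneg.
Qed.

Lemma sqnorm_rotation (c s : R) (z : R * R) : c ^+ 2 + s ^+ 2 = 1 ->
  sqnorm (c * z.1 - s * z.2, s * z.1 + c * z.2) = sqnorm z.
Proof.
move=> cs; rewrite /sqnorm/= -[RHS]mul1r -cs; ring.
Qed.

Lemma measurable_modulus_preimage B : measurable B -> measurable (@modulus R @^-1` B).
Proof. by move=> mB; rewrite -[X in measurable X]setTI; exact: measurable_modulus. Qed.

Lemma cint_rotation (c s : R) B f :
  c ^+ 2 + s ^+ 2 = 1 -> c != -1 -> measurable B -> cmeasurable f ->
  cint (@modulus R @^-1` B) (fun z => f (c * z.1 - s * z.2, s * z.1 + c * z.2)) =
  cint (@modulus R @^-1` B) f.
Proof.
move=> cs c1 mB [f1 f2]; rewrite /cint.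
have H (h : R * R -> R) : measurable_fun setT h ->
  (\int[leb2]_(z in @modulus R @^-1` B) (h (c * z.1 - s * z.2, s * z.1 + c * z.2)%R)%:E =
   \int[leb2]_(z in @modulus R @^-1` B) (h z)%:E)%E.
  move=> mh; rewrite integral_mkcond [RHS]integral_mkcond.
  rewrite -[RHS](integral_rotation cs c1); last first.
    apply: measurable_funT_restrict; first exact: measurable_modulus_preimage.
    exact/measurable_EFinP.
  apply: eq_integral => z _; rewrite /patch; congr (if _ then _ else _).
  by apply/idP/idP; rewrite !inE /= /modulus sqnorm_rotation.
by rewrite (H (fun z => complex.Re (f z)))// (H (fun z => complex.Im (f z))).
Qed.

(** For [w] of modulus 1 this is the integer power [w^(j - r)], the conjugate being the inverse. *)
Definition phase (r j : nat) (w : R[i]) : R[i] :=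
  if (r < j)%N then w ^+ (j - r) else (conjc w) ^+ (r - j).

Lemma phi_rotation r j (c s : R) (z : R * R) : c ^+ 2 + s ^+ 2 = 1 ->
  phi r j (c * z.1 - s * z.2, s * z.1 + c * z.2) = phase r j (Complex c s) * phi r j z.
Proof.
move=> cs; rewrite /phi /hermiteC sqnorm_rotation//.
have -> : toC (c * z.1 - s * z.2, s * z.1 + c * z.2) = Complex c s * toC z.
  by apply: complex_eq; rewrite ?ReM ?ImM/=; ring.
rewrite /phase; case: ifP => _; first by rewrite exprMn; ring.
by rewrite conjcM exprMn; ring.
Qed.

(** Clears the possibly negative exponent, so that phases are compared through natural powers of
    [w]. *)
Lemma phase_shift r j (w : R[i]) : sqnormc w = 1 -> w ^+ r * phase r j w = w ^+ j.
Proof.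
move=> w1; rewrite /phase; case: ltnP => rj.
  by rewrite -exprD subnKC// ltnW.
rewrite -{1}(subnK rj) addnC exprD -mulrA -exprMn mul_conjc w1.
by rewrite rmorph1 expr1n mulr1.
Qed.

Lemma sqnormc_phase r j (w : R[i]) : sqnormc w = 1 -> sqnormc (phase r j w) = 1.
Proof.
move=> w1; rewrite /phase; case: ifP => _; rewrite sqnormcX ?sqnormc_conj w1;
exact: expr1n.
Qed.

Lemma integral_radial_phi r j B : measurable B ->
  (\int[leb2]_(z in @modulus R @^-1` B) (sqnormc (phi r j z))%:E =
   \int[mu]_(x in B) (densY r j x)%:E)%E.
Proof.
move=> mB; rewrite integral_mkcond.
pose g : R -> \bar R := (EFin \o radial_phi r j) \_ B.
transitivity (\int[leb2]_z g (modulus z))%E.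
  by apply: eq_integral => z _; rewrite /g /patch sqnormc_phi; congr (if _ then _ else _);
    apply/idP/idP; rewrite !inE.
rewrite ge0_integral_polar; last 2 first.
- apply: measurable_funT_restrict => //; apply/measurable_EFinP.
  exact: measurable_radial_phi.
- by move=> x; apply: erestrict_ge0 => y _; rewrite lee_fin radial_phi_ge0.
rewrite integral_mkcond [RHS]integral_mkcond; apply: eq_integral => x _.
rewrite /g /patch (_ : (x \in `[0, +oo[%classic) = (0 <= x)); last first.
  by apply/idP/idP; rewrite inE/= in_itv/= andbT.
case: ifPn => [x0|x0]; last by rewrite /densY (negbTE x0); case: ifP.
by case: ifP => _; rewrite ?mule0// -EFinM radial_phi_densY.
Qed.

(** Supplied later by [integral_densY1], where [densY] is the density of a random variable. *)
Definition finite_density r j : Prop :=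
  (\int[mu]_x (densY (R := R) r j x)%:E < +oo)%E.

Lemma integrable_sqnormc_phi r j : finite_density r j ->
  leb2.-integrable setT (fun z => (sqnormc (phi r j z))%:E).
Proof.
have m := cmeasurable_sqnormc (@cmeasurable_phi R r j).
move=> fin; apply/integrableP; split; first exact/measurable_EFinP.
under eq_integral do rewrite gee0_abs ?lee_fin ?addr_ge0 ?sqr_ge0//.
by rewrite -(preimage_setT (@modulus R)) integral_radial_phi.
Qed.

(** The integrand is dominated by the sum of the two squared moduli, whose integrals are those of
    the densities. *)
Lemma cintegrable_phi r a b A : finite_density r a -> finite_density r b ->
  measurable A -> cintegrable A (fun z => phi r a z * conjc (phi r b z)).
Proof.
move=> fa fb mA.
have [m1 m2] := cmeasurableM (@cmeasurable_phi R r a)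
  (cmeasurable_conj (@cmeasurable_phi R r b)).
have dom : leb2.-integrable setT
    (fun z => (sqnormc (phi r a z))%:E + (sqnormc (phi r b z))%:E)%E.
  by apply: integrableD => //; exact: integrable_sqnormc_phi.
have H (h : R * R -> R) : measurable_fun setT h ->
    (forall z, `|h z| <= sqnormc (phi r a z) + sqnormc (phi r b z)) ->
    leb2.-integrable A (fun z => (h z)%:E).
  move=> mh hle; apply: (@integrableS _ _ _ _ setT) => //.
  apply: (le_integrable _ _ _ dom) => //; first exact/measurable_EFinP.
  by move=> z _; rewrite -EFinD lee_fin [leRHS]ger0_norm ?addr_ge0 ?sqr_ge0// hle.
have le2 (u v u' v' : R) : `|u * u' + v * v'| <= (u ^+ 2 + v ^+ 2) + (u' ^+ 2 + v' ^+ 2).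
  have := sqr_ge0 (u + u'); have := sqr_ge0 (u - u').
  have := sqr_ge0 (v + v'); have := sqr_ge0 (v - v').
  have := sqr_ge0 u; have := sqr_ge0 u'; have := sqr_ge0 v; have := sqr_ge0 v'.
  by move=> *; rewrite ler_norml; apply/andP; split; nra.
split; apply: H => // z; move: (phi r a z) (phi r b z) => x y; rewrite /sqnormc.
  by rewrite ReM Re_conjc Im_conjc mulrN opprK; exact: le2.
rewrite ImM Re_conjc Im_conjc -(sqrrN (complex.Im y)) [X in _ <= _ + X]addrC.
exact: le2.
Qed.

(** For [a <> b], a rotation by [w] preserves the annulus and multiplies the integrand by a constant
    [k], so the integral [I] satisfies [I = k I]. With [w] chosen so that its powers [a] and [b]
    differ, [k] is not 1 and [I] vanishes. *)
Lemma cint_radial r B a b : finite_density r a -> finite_density r b -> measurable B ->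
  cint (@modulus R @^-1` B) (fun z => phi r a z * conjc (phi r b z)) =
  if a == b then (fine (\int[mu]_(x in B) (densY r a x)%:E)%E)%:C%C else 0.
Proof.
move=> fa fb mB; case: eqP => [<-|ab].
  rewrite /cint; apply: complex_eq => /=.
    rewrite -integral_radial_phi//; congr fine; apply: eq_integral => z _.
    by rewrite mul_conjc.
  by rewrite (eq_integral (cst 0%E)) ?integral0// => z _; rewrite mul_conjc.
set A := @modulus R @^-1` B.
have mA : measurable A := measurable_modulus_preimage mB.
have [c [s [cs c1 neq]]] := @unit_expr_neq R a b ab.
set w := Complex c s in neq.
have w1 : sqnormc w = 1 by [].
pose k := phase r a w * conjc (phase r b w).
have I : cint A (fun z => phi r a z * conjc (phi r b z)) =
    k * cint A (fun z => phi r a z * conjc (phi r b z)).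
  rewrite -cintZ//; last exact: cintegrable_phi.
  rewrite -[LHS](cint_rotation cs c1 mB) -/A.
    congr (cint A _); apply/funext => z; rewrite !phi_rotation// conjcM /k.
    by rewrite mulrACA.
  apply: cmeasurableM; first exact: cmeasurable_phi.
  exact/cmeasurable_conj/cmeasurable_phi.
apply/eqP; have /eqP := I; rewrite -subr_eq0 -{1}(mul1r (cint _ _)) -mulrBl mulf_eq0.
case/orP => // /eqP k1; exfalso; apply: neq.
rewrite -(phase_shift r a w1) -(phase_shift r b w1); congr (_ * _).
have {k1} k1 : k = 1 by apply/eqP; rewrite eq_sym -subr_eq0 k1.
rewrite -[RHS]mul1r -k1 /k -mulrA (mulrC (conjc _)) mul_conjc sqnormc_phase//.
by rewrite rmorph1 mulr1.
Qed.

End RadialIntegrals.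
(** * Correlation functions *)

Section Determinants.
Variable K : fieldType.

Lemma det_mulmx_low_rank (k n : nat) (A : 'M[K]_(k, n)) (B : 'M[K]_(n, k)) :
  (n < k)%N -> \det (A *m B) = 0.
Proof.
move=> nk; apply/eqP; apply: contraTT nk => d0; rewrite -leqNgt.
have : \rank (A *m B) = k.
  by apply: mxrank_unit; rewrite unitmxE unitfE.
by move=> <-; exact: leq_trans (mxrankM_maxl _ _) (rank_leq_col _).
Qed.

(** A permutation extended by 0 to all naturals, so that it applies to indices below a size only
    provably equal to [n], without casts. *)
Definition perm_nat n (s : 'S_n) (i : nat) : nat :=
  oapp (fun o : 'I_n => val (s o)) 0%N (insub i).

Lemma perm_natE n (s : 'S_n) (i : 'I_n) : perm_nat s i = s i.
Proof. by rewrite /perm_nat valK. Qed.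

Lemma perm_nat_lt n (s : 'S_n) i : (i < n)%N -> (perm_nat s i < n)%N.
Proof. by move=> ni; rewrite (perm_natE s (Ordinal ni)). Qed.

(** The matrix is a product of two square ones; both determinants are expanded, giving a sum over
    pairs of permutations. *)
Lemma det_gram (k n : nat) (u v : nat -> nat -> K) : k = n ->
  \det (\matrix_(i < k, j < k) \sum_(a < n) u a i * v a j) =
  \sum_(p : 'S_n * 'S_n) (-1) ^+ p.1 * (-1) ^+ p.2 *
    \prod_(i < k) (u (perm_nat p.1 i) i * v (perm_nat p.2 i) i).
Proof.
move=> ->.
have -> : \matrix_(i < n, j < n) (\sum_(a < n) u a i * v a j) =
    (\matrix_(i < n, a < n) u a i) *m (\matrix_(j < n, a < n) v a j)^T.
  by apply/matrixP => i j; rewrite !mxE; apply: eq_bigr => a _; rewrite !mxE.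
rewrite det_mulmx det_tr /determinant big_distrlr/= pair_big/=.
apply: eq_bigr => -[s t] _ /=; rewrite mulrACA -big_split/=; congr (_ * _).
by apply: eq_bigr => i _; rewrite !mxE !perm_natE.
Qed.

End Determinants.

Section IteratedIntegrals.
Variable R : realType.
Local Notation mu := (@lebesgue_measure R).
Local Notation leb2 := (@leb2 R).

Lemma iintB_ext (Bs : seq (set (R * R))) F G :
  (forall s, size s = size Bs -> F s = G s) -> iintB Bs F = iintB Bs G.
Proof.
elim: Bs F G => [|B Bs ih] F G FG /=; first exact: FG.
by apply: eq_integral => z _; apply: ih => s sB; apply: FG; rewrite /= sB.
Qed.

Lemma iintB0 (Bs : seq (set (R * R))) : iintB Bs (fun=> 0%E) = 0%E.
Proof. by elim: Bs => [|B Bs ih] //=; under eq_integral do rewrite ih; exact: integral0. Qed.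

(** The induction absorbs the factor of the first variable into the coefficients [a], then
    integrates that variable out. *)
Lemma iintB_products (I : finType) (Bs : seq (set (R * R))) (a : I -> R[i])
    (f : I -> nat -> R * R -> R[i]) :
  (forall B, B \in Bs -> measurable B) ->
  (forall al i, (i < size Bs)%N -> forall A, measurable A -> cintegrable A (f al i)) ->
  iintB Bs (fun s => (complex.Re (\sum_al a al *
    \prod_(i < size Bs) f al i (nth (0, 0) s i)))%:E) =
  (complex.Re (\sum_al a al * \prod_(i < size Bs) cint (nth set0 Bs i) (f al i)))%:E.
Proof.
elim: Bs a f => [|B Bs ih] a f mB cf /=.
  by congr (complex.Re _)%:E; apply: eq_bigr => al _; rewrite !big_ord0.
have mB0 : measurable B by apply: mB; rewrite mem_head.
transitivity (\int[leb2]_(z in B) (complex.Re (\sum_al (a al * f al 0 z) *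
    \prod_(i < size Bs) cint (nth set0 Bs i) (f al i.+1)))%:E)%E.
  apply: eq_integral => z _.
  rewrite -(ih (fun al => a al * f al 0 z) (fun al i => f al i.+1)).
  - apply: iintB_ext => s sB; congr (complex.Re _)%:E; apply: eq_bigr => al _.
    by rewrite big_ord_recl/= mulrA.
  - by move=> A AB; apply: mB; rewrite inE AB orbT.
  - by move=> al i iB; exact: cf.
under eq_integral do rewrite Re_sum -sumEFin.
rewrite integral_sum//; last first.
  move=> al; under eq_fun do rewrite mulrAC.
  by apply: integrable_ReM => //; exact: cf.
rewrite Re_sum -sumEFin; apply: eq_bigr => al _.
under eq_integral do rewrite mulrAC.
rewrite integral_ReM//; last exact: cf.
by rewrite big_ord_recl/= mulrAC mulrA.
Qed.

Variables (r : nat) (J : seq nat).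
Local Notation n := (size J).
Hypothesis uJ : uniq J.

Lemma kernelK_nth (z z' : R * R) :
  kernelK r J z z' = \sum_(a < n) phi r (nth 0%N J a) z * conjc (phi r (nth 0%N J a) z').
Proof. by rewrite kernelK_phi (big_nth 0%N) big_mkord. Qed.

Lemma iintB_corrK_low_rank (Bs : seq (set (R * R))) : (n < size Bs)%N ->
  iintB Bs (fun s => (corrK (kernelK r J) s)%:E) = 0%E.
Proof.
move=> nB; rewrite -(iintB0 Bs); apply: iintB_ext => s sB; congr EFin.
rewrite /corrK.
have -> : \matrix_(i < size s, j < size s) kernelK r J (nth (0, 0) s i) (nth (0, 0) s j) =
    (\matrix_(i < size s, a < n) phi r (nth 0%N J a) (nth (0, 0) s i)) *m
    (\matrix_(a < n, j < size s) conjc (phi r (nth 0%N J a) (nth (0, 0) s j))).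
  apply/matrixP => i j; rewrite !mxE kernelK_nth.
  by apply: eq_bigr => a _; rewrite !mxE.
by rewrite det_mulmx_low_rank// sB.
Qed.

Hypothesis finJ : forall j, j \in J -> finite_density R r j.

Lemma iintB_corrK_setT :
  iintB [:: setT] (fun s => (corrK (kernelK r J) s)%:E) =
  (\sum_(j <- J) \int[mu]_x (densY r j x)%:E)%E.
Proof.
rewrite /=.
transitivity (\int[leb2]_z (\sum_(j <- J) (sqnormc (phi r j z))%:E))%E.
  apply: eq_integral => z _; rewrite /corrK det_mx11 mxE /= kernelK_phi Re_sum sumEFin.
  by congr EFin; apply: eq_bigr => j _; rewrite mul_conjc.
have m j := cmeasurable_sqnormc (@cmeasurable_phi R r j).
have me j : measurable_fun [set: R * R] (fun z => (sqnormc (phi r j z))%:E).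
  by apply/measurable_EFinP; exact: m.
have g0 j z : [set: R * R] z -> (0 <= (sqnormc (phi r j z))%:E)%E.
  by move=> _; rewrite lee_fin addr_ge0 ?sqr_ge0.
rewrite ge0_integral_sum//.
by apply: eq_bigr => j _; rewrite -integral_radial_phi// preimage_setT.
Qed.

Definition mass (j : nat) (A : set R) : R := fine (\int[mu]_(x in A) (densY r j x)%:E).

(** Two distinct permutations differ at some index, where the factor vanishes by orthogonality on
    the annulus. On the diagonal the two signs cancel, which leaves a permanent. *)
Lemma iintB_corrK_radial (As : seq (set R)) :
  (forall A, A \in As -> measurable A) -> size As = n ->
  iintB [seq @modulus R @^-1` A | A <- As] (fun s => (corrK (kernelK r J) s)%:E) =
  (\sum_(s : 'S_n) \prod_(i < n) mass (nth 0%N J (s i)) (nth set0 As i))%:E.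
Proof.
move=> mA sA; set Bs := map _ _.
have sB : size Bs = n by rewrite size_map.
pose f (p : 'S_n * 'S_n) (i : nat) (z : R * R) : R[i] :=
  phi r (nth 0%N J (perm_nat p.1 i)) z * conjc (phi r (nth 0%N J (perm_nat p.2 i)) z).
pose sg (p : 'S_n * 'S_n) : R[i] := (-1) ^+ p.1 * (-1) ^+ p.2.
transitivity (iintB Bs (fun s => (complex.Re (\sum_p sg p *
    \prod_(i < size Bs) f p i (nth (0, 0) s i)))%:E)).
  apply: iintB_ext => s ss; congr EFin; rewrite /corrK; congr complex.Re.
  rewrite -ss.
  rewrite -(det_gram (fun a i => phi r (nth 0%N J a) (nth (0, 0) s i))
    (fun a j => conjc (phi r (nth 0%N J a) (nth (0, 0) s j)))); last by rewrite ss.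
  by congr (\det _); apply/matrixP => i j; rewrite !mxE kernelK_nth.
rewrite iintB_products; last 2 first.
- by move=> B /mapP[A AA ->]; apply: measurable_modulus_preimage; exact: mA.
- move=> p i iB A mA'; apply: cintegrable_phi => //; apply/finJ/mem_nth/perm_nat_lt;
  by rewrite -sB.
congr EFin; rewrite sB.
have E (p : 'S_n * 'S_n) : sg p * \prod_(i < n) cint (nth set0 Bs i) (f p i) =
    if p.1 == p.2
    then (\prod_(i < n) mass (nth 0%N J (p.1 i)) (nth set0 As i))%:C%C else 0.
  have ci (i : 'I_n) : cint (nth set0 Bs i) (f p i) =
      if p.1 i == p.2 i then (mass (nth 0%N J (p.1 i)) (nth set0 As i))%:C%C else 0.
    rewrite (nth_map set0) ?sA// /f !perm_natE cint_radial.
    - by rewrite nth_uniq// -val_eqE.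
    - by apply/finJ/mem_nth.
    - by apply/finJ/mem_nth.
    - by apply: mA; rewrite mem_nth ?sA.
  rewrite (eq_bigr _ (fun i _ => ci i)); case: eqP => [pp|pp].
    rewrite /sg pp -signr_addb addbb mul1r rmorph_prod.
    by apply: eq_bigr => i _; rewrite eqxx.
  have [i pi] : exists i, p.1 i != p.2 i.
    apply/existsP; apply: contraT; rewrite negb_exists => /forallP h.
    by exfalso; apply: pp; apply/permP => i; have := h i; rewrite negbK => /eqP.
  by rewrite (bigD1 i)//= (negbTE pi) mul0r mulr0.
rewrite (eq_bigr _ (fun p _ => E p)) -(pair_big predT predT (fun s t : 'S_n =>
  if s == t then (\prod_(i < n) mass (nth 0%N J (s i)) (nth set0 As i))%:C%C else 0))/=.
rewrite Re_sum; apply: eq_bigr => s _.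
rewrite (bigD1 s)//= eqxx [X in _ + X](_ : _ = 0) ?addr0//.
by apply: big1 => t /negbTE; rewrite eq_sym => ->.
Qed.

End IteratedIntegrals.

(** * Separating sequences of sets *)

Section SeparatingSets.
Variable R : realType.

(** Rational end points, enumerated by [unpickle]; an index that codes no rational gets the end
    point 0. *)
Definition half_line (i : nat) : set R :=
  [set x | x < ratr (odflt 0 (unpickle i : option rat))].

Lemma measurable_half_line i : measurable (half_line i).
Proof.
by rewrite (_ : half_line i = `]-oo, (ratr (odflt 0 (unpickle i)))[%classic).
Qed.

Lemma half_line_sep (x y : R) : (forall i, half_line i x <-> half_line i y) -> x = y.
Proof.
wlog xy : x y / x < y.
  move=> h hxy; have [xy|xy|//] := ltgtP x y; first exact: h.
  by apply/esym/h => // i; apply: iff_sym.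
have [q] := rat_in_itvoo xy; rewrite in_itv/= => /andP[xq qy] /(_ (pickle q)).
rewrite /half_line/= pickleK/= => -[h _].
by have := lt_trans qy (h xq); rewrite ltxx.
Qed.

Definition plane_set (i : nat) : set (R * R) :=
  if odd i then [set z | half_line i./2 z.1] else [set z | half_line i./2 z.2].

Lemma measurable_plane_set i : measurable (plane_set i).
Proof.
rewrite /plane_set; case: odd; rewrite -[X in measurable X]setTI.
  exact: (measurable_fst measurableT _ (measurable_half_line _)).
exact: (measurable_snd measurableT _ (measurable_half_line _)).
Qed.

Lemma plane_set_sep (z z' : R * R) :
  (forall i, plane_set i z <-> plane_set i z') -> z = z'.
Proof.
case: z z' => [x y] [x' y'] h; congr (_, _); apply: half_line_sep => i.
  by have := h i.*2.+1; rewrite /plane_set/= odd_double/= uphalf_double.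
by have := h i.*2; rewrite /plane_set/= odd_double/= doubleK.
Qed.

(* The first [m] sets are those of interest, hence unions of cells from level [m]
   on; the half-lines make the sequence separating. *)
Definition prefixed_half_line m (B : 'I_m -> set R) (i : nat) : set R :=
  if insub i is Some o then B o else half_line (i - m).

Lemma prefixed_half_lineE m (B : 'I_m -> set R) (i : 'I_m) :
  prefixed_half_line B i = B i.
Proof. by rewrite /prefixed_half_line valK. Qed.

Lemma measurable_prefixed_half_line m (B : 'I_m -> set R) i :
  (forall o, measurable (B o)) -> measurable (prefixed_half_line B i).
Proof.
by move=> mB; rewrite /prefixed_half_line; case: insub => // ; exact: measurable_half_line.
Qed.

Lemma prefixed_half_line_sep m (B : 'I_m -> set R) (x y : R) :
  (forall i, prefixed_half_line B i x <-> prefixed_half_line B i y) -> x = y.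
Proof.
move=> h; apply: half_line_sep => i; have := h (m + i)%N.
by rewrite /prefixed_half_line insubN ?addKn// -leqNgt leq_addr.
Qed.

End SeparatingSets.

(** * The number of points *)

Section DeterminantalSide.
Variables (R : realType) (r : nat) (J : seq nat).
Context (d : measure_display) (Omega : measurableType d) (P : probability Omega R).
Variable N : Omega -> {measure set (R * R) -> \bar R}.
Hypothesis hN : is_determinantal P N (kernelK r J).
Local Notation n := (size J).
Local Open Scope ereal_scope.

Lemma prod_countsE (mu : set (R * R) -> \bar R) Bs :
  prod_counts mu Bs = \prod_(B <- Bs) mu B.
Proof. by elim: Bs => [|B Bs ih]; rewrite ?big_nil// big_cons /= ih. Qed.

Lemma moments_cells (E : nat -> set (R * R)) (mE : forall i, measurable (E i)) l
    (S : {set {ffun 'I_l -> bool}}) :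
  \int[P]_w \prod_(c in S) N w (cell E c) =
  iintB [seq cell E c | c <- enum S] (fun s => (corrK (kernelK r J) s)%:E).
Proof.
case: hN => _ <-.
- by apply: eq_integral => w _; rewrite prod_countsE big_map big_enum.
- by move=> B /mapP[c _ ->]; exact: measurable_cell.
- move=> i j /andP[ij]; rewrite size_map => jS.
  have iS := ltn_trans ij jS.
  have [c0 _] : exists c0, c0 \in S.
    by apply/set0Pn; rewrite -card_gt0 cardE (leq_ltn_trans _ jS).
  rewrite !(nth_map c0)//; apply/seteqP; split => // z [zi zj].
  have /eqP := cell_disjoint zi zj.
  by rewrite nth_uniq ?enum_uniq// ltn_eqF.
Qed.

Hypothesis densJ : forall j, j \in J ->
  \int[lebesgue_measure]_x (densY (R := R) r j x)%:E = 1.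

Let mN B : measurable B -> measurable_fun setT (fun w => N w B).
Proof. by case: hN => -[+ _ _ _] _; exact. Qed.

Let natN w B : measurable B -> (exists k : nat, N w B = k%:R%:E) \/ N w B = +oo.
Proof. by case: hN => -[_ + _ _] _; exact. Qed.

(** The determinantal identity for the single set [setT]: the diagonal of the kernel integrates to a
    sum of [n] unit masses. *)
Lemma integral_total_mass : \int[P]_w N w setT = n%:R%:E.
Proof.
have := (@iintB_corrK_setT R r J); case: hN => _ /(_ [:: setT]) <-.
- rewrite /prod_counts/=; under eq_integral do rewrite mule1.
  move=> ->; rewrite big_seq (eq_bigr (fun=> 1)) => [|j jJ]; last exact: densJ.
  rewrite -big_seq; elim: J => [|j s ih]; first by rewrite big_nil.
  by rewrite big_cons ih -EFinD -[1%R]/(1%:R)%R -natrD.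
- by move=> B; rewrite inE => /eqP ->.
- by move=> i [|j] /andP[].
Qed.

(** Products over more than [n] cells have expectation 0 by the rank bound, so almost surely they
    all vanish and [mass_le_cells] applies. *)
Lemma ae_total_mass_le : {ae P, forall w, N w setT <= n%:R%:E}.
Proof.
have mNT := mN (@measurableT _ (R * R)%type).
have iN : P.-integrable setT (fun w => N w setT).
  apply/integrableP; split => //.
  under eq_integral do rewrite gee0_abs//.
  by rewrite integral_total_mass ltry.
have finN := integrable_ae measurableT iN.
have mp l (S : {set {ffun 'I_l -> bool}}) :
    measurable_fun setT (fun w => \prod_(c in S) N w (cell (@plane_set R) c)).
  apply: emeasurable_prod => c; apply: mN; apply: measurable_cell => i.
  exact: measurable_plane_set.
have p0 l (S : {set {ffun 'I_l -> bool}}) w : 0 <= \prod_(c in S) N w (cell (@plane_set R) c).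
  by apply: prode_ge0.
(* Summing over [S] leaves one almost sure statement per level, hence countably many. *)
have ae0 : {ae P, forall w, forall l, \sum_(S : {set {ffun 'I_l -> bool}} | (n < #|S|)%N)
    \prod_(c in S) N w (cell (@plane_set R) c) = 0}.
  apply: ae_foralln => l.
  have ms : measurable_fun setT (fun w =>
      \sum_(S : {set {ffun 'I_l -> bool}} | (n < #|S|)%N)
      \prod_(c in S) N w (cell (@plane_set R) c)).
    under eq_fun do rewrite big_mkcond.
    by apply: emeasurable_sum => S; case: (n < #|S|)%N.
  have s0 w : 0 <= \sum_(S : {set {ffun 'I_l -> bool}} | (n < #|S|)%N)
      \prod_(c in S) N w (cell (@plane_set R) c).
    by apply: sume_ge0 => S _; exact: p0.
  have := @ae_eq_integral_abs _ _ _ P setT measurableT _ ms => -[+ _].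
  under eq_integral do rewrite gee0_abs//.
  move=> h; have {}h := h _; apply: filterS (h _) => [w|]; first by apply.
  under eq_integral do rewrite -big_filter.
  rewrite ge0_integral_sum//; first last.
  rewrite big_filter big1// => S nS; rewrite moments_cells; last exact: measurable_plane_set.
  by rewrite iintB_corrK_low_rank// size_map -cardE.
apply: filterS2 ae0 finN => w w0 /(_ I) fw.
apply: (mass_le_cells (@measurable_plane_set R) (@plane_set_sep R)).
- by move=> B; exact: natN.
- by rewrite -ge0_fin_numE.
- by case: hN => -[_ _ _ +] _; exact.
- move=> l S nS; have /eqP := w0 l; rewrite (bigD1 S)//= padde_eq0//.
  + by case/andP => /eqP.
  + exact: p0.
  + by apply: sume_ge0 => S1 _; exact: p0.
Qed.

(** Counts are integers, so on the event [D] that the count is not [n] it is at most [n - 1]. Thus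
    the count plus the indicator of [D] is almost surely at most [n], and taking expectations forces
    [P D = 0]. *)
Lemma ae_total_mass : {ae P, forall w, N w setT = n%:R%:E}.
Proof.
have mNT := mN (@measurableT _ (R * R)%type).
pose D := [set w | N w setT != n%:R%:E].
have mD : measurable D.
  rewrite (_ : D = ~` ((fun w => N w setT) @^-1` [set n%:R%:E])).
    by apply: measurableC; rewrite -[X in measurable X]setTI; exact: mNT.
  by apply/seteqP; split => w /= /eqP.
suff PD : P D = 0.
  exists D; split => // w /= h; exact/eqP.
have : \int[P]_w (N w setT + (\1_D w)%:E) <= \int[P]_w n%:R%:E.
  apply: ae_ge0_le_integral => //.
  - by move=> w _; rewrite adde_ge0// lee_fin.
  - apply: emeasurable_funD => //; apply/measurable_EFinP; exact: measurable_indic.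
  apply: filterS ae_total_mass_le => w le_n _.
  rewrite indicE; case: (boolP (w \in D)) => [|_]; last by rewrite adde0.
  rewrite inE => /= neq.
  case: (natN w (@measurableT _ (R * R)%type)) => [[k kE]|oo]; last by rewrite oo in le_n.
  have kn : k != n by apply: contraTneq isT => kn; case/negP: neq; rewrite kE kn.
  move: le_n; rewrite kE lee_fin ler_nat => kn'.
  by rewrite -EFinD lee_fin -[1%R]/(1%:R)%R -natrD ler_nat addn1 ltn_neqAle kn.
rewrite ge0_integralD//; last exact/measurable_EFinP/measurable_indic.
rewrite integral_total_mass integral_indic// setIT integral_cst//.
rewrite (_ : _ * _ = n%:R%:E); last first.
  by rewrite -[RHS]mule1; congr (_ * _); exact: probability_setT.
rewrite -leeBrDl// subee// => PD0.
by apply/eqP; rewrite eq_le PD0 measure_ge0.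
Qed.

End DeterminantalSide.
(** * Independent variables *)

Lemma measure_finType_bigcup_le d (T : measurableType d) (R : realType)
    (m : {measure set T -> \bar R}) (I : finType) (P : pred I) (F : I -> set T) :
  (forall i, measurable (F i)) ->
  (m [set x | exists2 i, P i & F i x] <= \sum_(i | P i) m (F i))%E.
Proof.
move=> mF.
pose s := [seq i <- index_enum I | P i].
have -> : [set x | exists2 i, P i & F i x] = \big[setU/set0]_(i <- s) F i.
  rewrite -bigcup_seq; apply/seteqP; split => x /= [i Pi Fi]; exists i => //.
    by rewrite /= mem_filter Pi mem_index_enum.
  by move: Pi; rewrite /= mem_filter => /andP[].
rewrite -[leRHS]big_filter -/s; elim: s => [|i s ih]; first by rewrite !big_nil measure0.
rewrite !big_cons; apply: le_trans (leeD2l _ ih).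
by apply: measureU2 => //; exact: bigsetU_measurable.
Qed.

Section IndependentSide.
Variables (R : realType) (J : seq nat).
Hypothesis uJ : uniq J.
Context (d : measure_display) (Omega : measurableType d) (P : probability Omega R).
Variable Y : nat -> Omega -> R.
Hypothesis mY : forall j, j \in J -> measurable_fun setT (Y j).
Hypothesis indY : mutually_independent P J Y.
Local Notation n := (size J).
Local Notation Yn a := (Y (nth 0%N J a)).
Local Open Scope ereal_scope.

Definition occ (A : set R) (w : Omega) : \bar R := \sum_(a < n) (\1_A (Yn a w))%:E.

Lemma occ_count A w : occ A w = (count (fun j => `[< A (Y j w) >]) J)%:R%:E.
Proof.
rewrite /occ sumEFin -sum1_count [in RHS]big_mkcond natr_sum (big_nth 0%N) big_mkord.
by congr EFin; apply: eq_bigr => a _; rewrite indicE.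
Qed.

Lemma measurable_preim a A : (a < n)%N -> measurable A -> measurable (Yn a @^-1` A).
Proof.
move=> an mA; rewrite -[X in measurable X]setTI.
by apply: mY => //; exact: mem_nth.
Qed.

Lemma measurable_indic_Y a A : (a < n)%N -> measurable A ->
  measurable_fun setT (fun w => (\1_A (Yn a w) : R)).
Proof.
move=> an mA; apply: (measurable_indic (U := Yn a @^-1` A)).
exact: measurable_preim.
Qed.

Lemma measurable_occ A : measurable A -> measurable_fun setT (occ A).
Proof.
move=> mA; apply: emeasurable_sum => a; apply/measurable_EFinP.
exact: measurable_indic_Y.
Qed.

Section Cells.
Variables (E : nat -> set R) (mE : forall i, measurable (E i)).

Lemma sum_occ_coord l (i : 'I_l) w :
  \sum_(c : {ffun 'I_l -> bool} | c i) occ (cell E c) w = occ (E i) w.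
Proof.
rewrite exchange_big/=; apply: eq_bigr => a _.
(* Each variable is treated as a Dirac mass, to which the partition identity applies. *)
have := measure_cells_coord mE (@dirac _ _ (Yn a w) R : {measure set R -> \bar R}) i.
rewrite /= /dirac => ->; exact: eq_bigr.
Qed.

Lemma sum_occ l w : \sum_(c : {ffun 'I_l -> bool}) occ (cell E c) w = n%:R%:E.
Proof.
rewrite exchange_big/= (eq_bigr (fun=> 1)) => [|a _].
  by rewrite sumEFin sumr_const card_ord.
have := measure_cells mE (@dirac _ _ (Yn a w) R : {measure set R -> \bar R}) l.
by rewrite /= /dirac indicE mem_set// => ->.
Qed.
End Cells.

Lemma independent_functional (g : 'I_n -> 'I_n) (As : 'I_n -> set R) :
  (forall i, measurable (As i)) -> injective g ->
  P [set w | forall i, As i (Yn (g i) w)] = \prod_(i < n) P (Yn (g i) @^-1` As i).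
Proof.
move=> mA injg.
(* Reindexes the constraints by elements of [J]: [B j] is [As i] for the only [i] that [g] sends to
   the position of [j]. *)
pose B j := [set x | forall i, nth 0%N J (g i) = j -> As i x].
have nthg i i' : nth 0%N J (g i) = nth 0%N J (g i') -> i = i'.
  by move=> /eqP; rewrite nth_uniq// => /eqP/val_inj/injg.
have BE i : B (nth 0%N J (g i)) = As i.
  apply/seteqP; split => x /=; first exact.
  by move=> Ax i' /nthg ->.
have mB j : measurable (B j).
  have -> : B j = \bigcap_(i in [set i | nth 0%N J (g i) = j]) As i.
    by apply/seteqP; split => x h i; exact: h.
  by apply: fin_bigcap_measurable => // i _.
have [g' gK g'K] : bijective g by exact: injF_bij.
transitivity (P (\bigcap_(j in [set` J]) (Y j @^-1` B j))).
  congr (P _); apply/seteqP; split => w /= h.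
    by move=> j /= jJ i <-.
  move=> i; rewrite -BE; apply: (h (nth 0%N J (g i))).
  by rewrite /= mem_nth.
rewrite indY// (big_nth 0%N) big_mkord (reindex g)/=; last by exists g' => i _.
by apply: eq_bigr => i _; rewrite BE.
Qed.

Lemma independent_pair (a b : 'I_n) (A B : set R) : a != b ->
  measurable A -> measurable B ->
  P ((Yn a @^-1` A) `&` (Yn b @^-1` B)) = P (Yn a @^-1` A) * P (Yn b @^-1` B).
Proof.
move=> ab mA mB.
pose As (i : 'I_n) : set R := if i == a then A else if i == b then B else setT.
have ba : (b == a) = false by rewrite eq_sym (negbTE ab).
have := @independent_functional id As; rewrite (bigD1 a)//= (bigD1 b)/=; last by rewrite eq_sym.
rewrite big1 => [|i /andP[ia ib]]; last first.
  by rewrite /As (negbTE ia) (negbTE ib) preimage_setT probability_setT.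
have Aa : As a = A by rewrite /As eqxx.
have Ab : As b = B by rewrite /As ba eqxx.
rewrite mule1 Aa Ab => <-//.
- congr (P _); apply/seteqP; split => w /=.
    by move=> [Aw Bw] i; rewrite /As; case: eqP => [->//|_]; case: eqP => [->|].
  by move=> h; split; [rewrite -Aa|rewrite -Ab]; exact: h.
- by move=> i; rewrite /As; case: ifP => // _; case: ifP.
Qed.

(** Expanding the product of sums gives one term per map [g] from sets to variables. A [g] that is
    not injective would put one variable in two disjoint sets; the injective ones are the
    permutations. *)
Lemma moments_occ (As : 'I_n -> set R) :
  (forall i, measurable (As i)) ->
  (forall i i' x, As i x -> As i' x -> i = i') ->
  \int[P]_w \prod_(i < n) occ (As i) w =
  \sum_(s : 'S_n) \prod_(i < n) P (Yn (s i) @^-1` As i).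
Proof.
move=> mA tA.
pose F (g : {ffun 'I_n -> 'I_n}) := [set w | forall i, As i (Yn (g i) w)].
have mF g : measurable (F g).
  have -> : F g = \bigcap_(i in [set: 'I_n]) (Yn (g i) @^-1` As i).
    by apply/seteqP; split => w h i => [_|]; [exact: h|exact: (h i I)].
  by apply: fin_bigcap_measurable => // i _; exact: measurable_preim.
transitivity (\int[P]_w \sum_(g : {ffun 'I_n -> 'I_n}) (\1_(F g) w)%:E).
  apply: eq_integral => w _.
  under eq_bigr do rewrite /occ sumEFin.
  rewrite -(big_morph EFin EFinM (erefl _)) bigA_distr_bigA/= -sumEFin.
  apply: eq_bigr => g _; congr EFin; rewrite indicE.
  case: (boolP (w \in F g)) => [|/negP wF].
    by rewrite inE => wF; rewrite big1// => i _; rewrite indicE mem_set//; exact: wF.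
  have [i wi] : exists i, ~ As i (Yn (g i) w).
    by apply/existsNP => h; apply: wF; rewrite inE.
  by rewrite (bigD1 i)//= indicE memNset// mul0r.
have mI g : measurable_fun setT (fun w => (\1_(F g) w)%:E : \bar R).
  by apply/measurable_EFinP; exact: measurable_indic.
rewrite ge0_integral_sum//.
under eq_bigr do rewrite integral_indic// setIT.
rewrite (bigID (fun g : {ffun 'I_n -> 'I_n} => injectiveb g))/= [X in _ + X]big1.
  rewrite adde0 (reindex (@pval _)) /=; last first.
    pose in_Sn := insubd (1%g : 'S_n).
    by exists in_Sn => /= f Uf; first apply: val_inj; apply: insubdK.
  apply: eq_big => /= [s|s _]; first by rewrite (valP s).
  rewrite -independent_functional//; last exact: perm_inj.
  by congr (P _); apply/seteqP; split => w /= h i; have := h i; rewrite pvalE.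
move=> g /injectivePn[i [i' ii' gi]].
rewrite (_ : F g = set0) ?measure0//; apply/seteqP; split => // w h.
have hi' := h i'; rewrite -gi in hi'.
by rewrite (tA _ _ _ (h i) hi') eqxx in ii'.
Qed.

End IndependentSide.

(** * Variables sharing a cell *)

Section Collisions.
Variables (R : realType) (J : seq nat).
Hypothesis uJ : uniq J.
Context (d : measure_display) (Omega : measurableType d) (P : probability Omega R).
Variable Y : nat -> Omega -> R.
Hypothesis mY : forall j, j \in J -> measurable_fun setT (Y j).
Hypothesis indY : mutually_independent P J Y.
Hypothesis atomless : forall j x, j \in J -> P (Y j @^-1` [set x]) = 0%E.
Variable E : nat -> set R.
Hypothesis mE : forall i, measurable (E i).
Hypothesis sepE : forall x y, (forall i, E i x <-> E i y) -> x = y.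
Local Notation n := (size J).
Local Notation Yn a := (Y (nth 0%N J a)).
Local Open Scope ereal_scope.

Definition cell_occ l (w : Omega) (c : {ffun 'I_l -> bool}) : \bar R :=
  occ J Y (cell E c) w.

(** For independent variables the inner sum is the probability that the two of them share a cell of
    level [l]. *)
Definition collision l : \bar R :=
  \sum_(p : 'I_n * 'I_n | p.1 != p.2) \sum_(c : {ffun 'I_l -> bool})
    P (Yn p.1 @^-1` cell E c) * P (Yn p.2 @^-1` cell E c).

Lemma config_event_distinct l w :
  (forall a b : 'I_n, code E l (Yn a w) = code E l (Yn b w) -> a = b) ->
  exists S, config_event (@cell_occ l) S w.
Proof.
move=> inj; exists [set code E l (Yn a w) | a : 'I_n]%SET => c.
rewrite /cell_occ /occ sumEFin; congr EFin.
have I1 a : \1_(cell E c) (Yn a w) = (code E l (Yn a w) == c)%:R :> R.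
  rewrite indicE (_ : (Yn a w \in cell E c) = (code E l (Yn a w) == c))//.
  by apply/idP/eqP; rewrite inE.
under eq_bigr do rewrite I1.
case: imsetP => [[a _ ca]|h]; last first.
  apply: big1 => a _; case: eqP => // ac; exfalso; apply: h.
  by exists a.
rewrite (bigD1 a)//= -ca eqxx big1 ?addr0// => b ba.
by case: eqP => // h; rewrite ca in h; rewrite (inj _ _ h) eqxx in ba.
Qed.

(** An outcome in no configuration has two variables with the same code; the union bound over pairs
    concludes. *)
Lemma collision_bound l :
  1 - \sum_S P (config_event (@cell_occ l) S) <= collision l.
Proof.
have mx (c : {ffun 'I_l -> bool}) : measurable_fun setT ((@cell_occ l) ^~ c).
  by apply: measurable_occ => //; exact: measurable_cell.
pose G := [set w | exists2 S, true & config_event (@cell_occ l) S w].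
have PG : P G = \sum_S P (config_event (@cell_occ l) S).
  by apply: measure_finType_bigcup; [exact: measurable_config_event|exact: config_event_inj].
have mG : measurable G.
  have -> : G = \bigcup_(S in [set: {set {ffun 'I_l -> bool}}]) config_event (@cell_occ l) S.
    by apply/seteqP; split => w /= [S]; exists S.
  by apply: fin_bigcup_measurable => // S _; exact: measurable_config_event.
rewrite -PG -probability_setC//.
pose K (p : 'I_n * 'I_n) := [set w | exists2 c : {ffun 'I_l -> bool}, true &
  ((Yn p.1 @^-1` cell E c) `&` (Yn p.2 @^-1` cell E c)) w].
have mKc (p : 'I_n * 'I_n) (c : {ffun 'I_l -> bool}) :
    measurable ((Yn p.1 @^-1` cell E c) `&` (Yn p.2 @^-1` cell E c)).
  by apply: measurableI; apply: (measurable_preim mY) => //; exact: measurable_cell.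
have mK p : measurable (K p).
  have -> : K p = \bigcup_(c in [set: {ffun 'I_l -> bool}])
      ((Yn p.1 @^-1` cell E c) `&` (Yn p.2 @^-1` cell E c)).
    by apply/seteqP; split => w /= [c]; exists c.
  by apply: fin_bigcup_measurable => // c _; exact: mKc.
have PK (p : 'I_n * 'I_n) : p.1 != p.2 ->
    P (K p) = \sum_(c : {ffun 'I_l -> bool}) P (Yn p.1 @^-1` cell E c) * P (Yn p.2 @^-1` cell E c).
  move=> p12; transitivity (\sum_(c : {ffun 'I_l -> bool})
      P ((Yn p.1 @^-1` cell E c) `&` (Yn p.2 @^-1` cell E c))).
    apply: measure_finType_bigcup; first exact: mKc.
    by move=> c c' w [Yc _] [Yc' _]; exact: cell_disjoint Yc Yc'.
  by apply: eq_bigr => c _; apply: (independent_pair uJ) => //; exact: measurable_cell.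
apply: (@le_trans _ _ (P [set w | exists2 p, p.1 != p.2 & K p w])).
  apply: le_measure; rewrite ?inE//.
  - exact: measurableC.
  - have -> : [set w | exists2 p, p.1 != p.2 & K p w] =
        \bigcup_(p in [set p : 'I_n * 'I_n | p.1 != p.2]) K p by [].
    by apply: fin_bigcup_measurable => // p _; exact: mK.
  move=> w nG; apply: contrapT => h; apply: nG.
  have [] := @config_event_distinct l w; last by move=> S; exists S.
  move=> a b ab; apply/eqP; apply: contraT => neq; exfalso; apply: h.
  by exists (a, b) => //; exists (code E l (Yn a w)).
apply: le_trans (measure_finType_bigcup_le _ _ mK) _.
by rewrite le_eqVlt; apply/orP; left; apply/eqP; apply: eq_bigr => p; exact: PK.
Qed.

(** By [cvg_cells_product], each pair contributes in the limit the integral of one law's point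
    masses against the other law, and the laws have no atoms. *)
Lemma cvg_collision : collision @ \oo --> 0.
Proof.
rewrite (_ : 0 = \sum_(p : 'I_n * 'I_n | p.1 != p.2) 0); last by rewrite big1.
apply: cvg_nnesum => p _.
  by apply: nearW => l; apply: sume_ge0 => c _; rewrite mule_ge0.
have pf (a : 'I_n) : exists m : {measure set R -> \bar R},
    forall A, m A = P (Yn a @^-1` A).
  have mYa : measurable_fun setT (Yn a) by apply: mY; exact: mem_nth.
  pose m := (pushforward P (Yn a) : {measure set R -> \bar R}).
  by exists (m mYa).
have [m1 m1E] := pf p.1; have [m2 m2E] := pf p.2.
have fin m (a : 'I_n) : (forall A, m A = P (Yn a @^-1` A)) -> m setT < +oo.
  by move=> ->; rewrite preimage_setT probability_setT ltry.
have := cvg_cells_product mE sepE (fin _ _ m2E) (fin _ _ m1E).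
rewrite (_ : \int[m2]_x m1 [set x] = 0); last first.
  rewrite (eq_integral (cst 0)) ?integral0// => x _.
  by rewrite m1E atomless//; exact: mem_nth.
by under eq_fun do under eq_bigr do rewrite m1E m2E.
Qed.

End Collisions.

(** * Equality of the configuration probabilities *)

Section ConfigurationLaws.
Variables (R : realType) (r : nat) (J : seq nat).
Hypothesis uJ : uniq J.
Context (d : measure_display) (Omega : measurableType d) (P : probability Omega R).
Variable N : Omega -> {measure set (R * R) -> \bar R}.
Hypothesis hN : is_determinantal P N (kernelK r J).
Context (d' : measure_display) (Omega' : measurableType d') (P' : probability Omega' R).
Variable Y : nat -> Omega' -> R.
Hypothesis mY : forall j, j \in J -> measurable_fun setT (Y j).
Hypothesis indY : mutually_independent P' J Y.
Hypothesis densityY : forall j, j \in J -> has_density P' (Y j) (densY (R:=R) r j).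
Variable E : nat -> set R.
Hypothesis mE : forall i, measurable (E i).
Local Notation n := (size J).
Local Open Scope ereal_scope.

(** The cells of [E2] are, by conversion, the preimages under [modulus] of the cells of [E]. *)
Let E2 i : set (R * R) := @modulus R @^-1` E i.

Definition cell_count l (w : Omega) (c : {ffun 'I_l -> bool}) : \bar R :=
  N w (@modulus R @^-1` cell E c).

Lemma integral_densY1 j : j \in J ->
  \int[lebesgue_measure]_x (densY (R := R) r j x)%:E = 1.
Proof. by move=> jJ; rewrite -densityY// preimage_setT probability_setT. Qed.

Lemma massE j A : j \in J -> measurable A -> (mass r j A)%:E = P' (Y j @^-1` A).
Proof.
move=> jJ mA; rewrite /mass -densityY// fineK// fin_num_measure//.
by rewrite -[X in measurable X]setTI; exact: mY.
Qed.

Let mE2 i : measurable (E2 i).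
Proof. exact: measurable_modulus_preimage. Qed.

Lemma ae_cell_count l : {ae P, forall w,
  (forall c : {ffun 'I_l -> bool}, exists k : nat, cell_count w c = k%:R%:E) /\
  \sum_(c : {ffun 'I_l -> bool}) cell_count w c = n%:R%:E}.
Proof.
apply: filterS (ae_total_mass hN integral_densY1) => w Nw; split => [c|].
  have mc := measurable_cell mE2 c.
  case: hN => -[_ /(_ w _ mc)[//|oo] _ _] _.
  have : N w (cell E2 c) <= N w setT by apply: le_measure; rewrite ?inE.
  by rewrite oo Nw leye_eq.
by rewrite -Nw (measure_cells mE2 (N w) l).
Qed.

(** Both probabilities are 0 unless [S] has [n] elements; then they are expected products of counts,
    both equal to the same permanent of the probabilities that [Y j] falls in a cell. *)
Lemma config_event_law l (S : {set {ffun 'I_l -> bool}}) :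
  P (config_event (@cell_count l) S) = P' (config_event (@cell_occ R J _ Omega' Y E l) S).
Proof.
have mx (c : {ffun 'I_l -> bool}) : measurable_fun setT ((@cell_count l) ^~ c).
  by case: hN => -[+ _ _ _] _; apply; exact: (measurable_cell mE2 c).
have my (c : {ffun 'I_l -> bool}) :
    measurable_fun setT ((@cell_occ R J _ Omega' Y E l) ^~ c).
  by apply: measurable_occ => //; exact: measurable_cell.
rewrite (probability_config_event mx S (ae_cell_count l)).
rewrite (@probability_config_event _ _ _ _ P' _ my n S); last first.
  apply: aeW => w; split => [c|]; last exact: sum_occ.
  by eexists; exact: occ_count.
case: eqP => // Sn.
pose c0 : {ffun 'I_l -> bool} := [ffun=> false].
pose As (i : 'I_n) := cell E (nth c0 (enum S) i).
have mAs i : measurable (As i) by exact: measurable_cell.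
have sS : size (enum S) = n by rewrite -cardE.
transitivity (\sum_(s : 'S_n) \prod_(i < n) P' (Y (nth 0%N J (s i)) @^-1` As i)).
  rewrite (moments_cells hN mE2).
  have -> : [seq cell E2 c | c <- enum S] =
      [seq @modulus R @^-1` A | A <- [seq cell E c | c <- enum S]].
    by rewrite -map_comp.
  rewrite iintB_corrK_radial//.
  - rewrite -sumEFin; apply: eq_bigr => s _.
    rewrite (big_morph EFin EFinM (erefl _)); apply: eq_bigr => i _.
    by rewrite (nth_map c0) ?sS//; apply: massE; [exact: mem_nth|exact: mAs].
  - by move=> j jJ; rewrite /finite_density; have -> := integral_densY1 jJ; rewrite ltry.
  - by move=> A /mapP[c _ ->]; exact: measurable_cell.
  - by rewrite size_map.
rewrite -(moments_occ uJ mY indY mAs).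
  apply: eq_integral => w _.
  transitivity (\prod_(c <- enum S) cell_occ J Y E w c); last by rewrite big_enum.
  by rewrite (big_nth c0) sS big_mkord.
move=> i i' x xi xi'; have /eqP := cell_disjoint xi xi'.
by rewrite nth_uniq ?sS ?enum_uniq// => /eqP/val_inj.
Qed.

End ConfigurationLaws.

(** * Comparison of the joint counts *)

Theorem theorem6p2 (R : realType) (r : nat) (J : seq nat) (uJ : uniq J)
  (d : measure_display) (Omega : measurableType d) (P : probability Omega R)
  (N : Omega -> {measure set (R * R) -> \bar R})
  (hN : is_determinantal P N (kernelK r J))
  (d' : measure_display) (Omega' : measurableType d') (P' : probability Omega' R)
  (Y : nat -> Omega' -> R)
  (hYm : forall j, j \in J -> measurable_fun setT (Y j))
  (hYind : mutually_independent P' J Y)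
  (hYdens : forall j, j \in J -> has_density P' (Y j) (densY (R:=R) r j)) :
  forall (m : nat) (B : 'I_m -> set R) (k : 'I_m -> nat),
    (forall i, measurable (B i)) ->
    (forall i, B i `<=` `[0, +oo[%classic) ->
    P [set w | forall i, N w (modulus (R:=R) @^-1` B i) = ((k i)%:R)%:E] =
    P' [set w | forall i, count (fun j => `[< B i (Y j w) >]) J = k i].
Proof.
move=> m B k mB _.
pose E := prefixed_half_line B.
have mE i : measurable (E i) by exact: measurable_prefixed_half_line.
have sepE : forall x y, (forall i, E i x <-> E i y) -> x = y.
  exact: prefixed_half_line_sep.
have mE2 i : measurable (@modulus R @^-1` E i) by exact: measurable_modulus_preimage.
(* From level [m] on, [B i] is the union of the cells whose code is true at [i], so both events are
   count events at every level [m + l]. *)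
pose sel l (i : 'I_m) := [pred c : {ffun 'I_(m + l) -> bool} | c (lshift l i)].
set Ev := [set w | _]; set Ev' := [set w | _].
have EvE l : Ev = count_event (cell_count N E (l := m + l)) (sel l) k.
  apply/seteqP; split => w /= h i; have := h i;
  rewrite -(prefixed_half_lineE B i) -/E -[i : nat]/(lshift l i : nat);
  by rewrite (measure_cells_coord mE2 (N w) (lshift l i)).
have Ev'E l : Ev' = count_event (cell_occ J Y E (l := m + l)) (sel l) k.
  have e w i : (\sum_(c | sel l i c) cell_occ J Y E (l := m + l) w c =
      (count (fun j => `[< B i (Y j w) >]) J)%:R%:E)%E.
    rewrite -(prefixed_half_lineE B i) -occ_count.
    exact: (sum_occ_coord J Y mE (lshift l i)).
  apply/seteqP; split => w /= h i; first by rewrite e h.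
  by have /eqP := h i; rewrite e eqe eqr_nat => /eqP.
have mx l (c : {ffun 'I_l -> bool}) :
    measurable_fun setT (fun w => cell_count N E (l := l) w c).
  by case: hN => -[h _ _ _] _; apply: h; exact: (measurable_cell mE2 c).
have my l (c : {ffun 'I_l -> bool}) :
    measurable_fun setT (fun w => cell_occ J Y E (l := l) w c).
  by apply: (measurable_occ hYm); exact: measurable_cell.
have law l S : P (config_event (cell_count N E (l := l)) S) =
    P' (config_event (cell_occ J Y E (l := l)) S).
  exact: (config_event_law uJ hN hYm hYind hYdens mE).
(* The accepted configurations have the same total probability on both sides, and so do the
   undecided outcomes, which [collision] bounds. *)
have bound l : (P Ev <= P' Ev' + collision J P' Y E (m + l))%E /\
    (P' Ev' <= P Ev + collision J P' Y E (m + l))%E.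
  have /andP[lo hi] := count_event_bounds P (mx (m + l)%N) (sel l) k.
  have /andP[lo' hi'] := count_event_bounds P' (my (m + l)%N) (sel l) k.
  have cb := collision_bound uJ hYm hYind mE (m + l).
  rewrite -EvE in lo hi; rewrite -Ev'E in lo' hi'.
  have lawE (p : pred {set {ffun 'I_(m + l) -> bool}}) :
      (\sum_(S | p S) P (config_event (cell_count N E (l := m + l)) S) =
       \sum_(S | p S) P' (config_event (cell_occ J Y E (l := m + l)) S))%E.
    by apply: eq_bigr => S _; exact: law.
  rewrite !lawE in lo hi.
  split; [apply: (le_trans hi)|apply: (le_trans hi')]; exact: leeD.
have atomless j x : j \in J -> P' (Y j @^-1` [set x]) = 0%E.
  by move=> jJ; rewrite hYdens// integral_set1.
have small e : (0 < e)%R -> exists l, (collision J P' Y E (m + l) <= e%:E)%E.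
  move=> e0; have e0' : (0 < e%:E)%E by rewrite lte_fin.
  have /open_ereal_lt' := e0' => /(cvg_collision hYm atomless mE sepE)[l _ h].
  by exists l; apply/ltW; apply: h => /=; exact: leq_addl.
apply/eqP; rewrite eq_le; apply/andP; split; apply/lee_addgt0Pr => e e0;
  have [l le] := small e e0; have [b1 b2] := bound l.
  by apply: (le_trans b1); exact: leeD2l.
by apply: (le_trans b2); exact: leeD2l.
Qed.
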